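(* Let $m$, $k$, $t$ be positive integers. Then: (i) the class of $mK_t$-free graphs is $(t-1)$-strongly Pollyanna; (ii) the class of $(t,k)$-pineapple-free graphs is $(2t-4)$-strongly Pollyanna; (iii) the class of $t$-lollipop-free graphs is $(3t-6)$-strongly Pollyanna; (iv) the class of bowtie-free graphs is $3$-strongly Pollyanna; (v) the class of bull-free graphs is $2$-strongly Pollyanna.
   Context: All graphs are finite and simple; $H$-free means no induced subgraph isomorphic to $H$; $\chi$ and $\omega$ denote chromatic and clique number. A class $\mathcal F$ of graphs is polynomially $\chi$-bounded if there is a polynomial $f$ with $\chi(H)\le f(\omega(H))$ for every induced subgraph $H$ of every graph in $\mathcal F$. For an integer $n$, $\chi^{(n)}(G)$ denotes the maximum chromatic number of an induced subgraph $H$ of $G$ with $\omega(H)\le n$. A class $\mathcal F$ of graphs is $n$-good if it is closed under taking induced subgraphs and there is a constant $c$ with $\chi^{(n)}(G)\le c$ for all $G\in\mathcal F$. A class $\mathcal C$ is $n$-strongly Pollyanna if $\mathcal C\cap\mathcal F$ is polynomially $\chi$-bounded for every $n$-good class $\mathcal F$. $mK_t$ is the disjoint union of $m$ copies of $K_t$. A $(t,k)$-pineapple is obtained from $K_t$ by attaching $k$ pendant edges at a single vertex of $K_t$. A $t$-lollipop is obtained from the disjoint union of $K_t$ and a path $P_2$ on two vertices by adding one edge between a vertex of the $K_t$ and a vertex of the $P_2$. A bowtie is obtained from two disjoint copies of $K_2$ by adding a new vertex adjacent to all four other vertices. A bull consists of a triangle $abc$ and two further vertices $d,e$ with $d$ adjacent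 only to $a$ and $e$ adjacent only to $b$. *)

(* Defs.v *)
From HB Require Import structures.
From mathcomp Require Import all_boot all_order all_algebra.

Set Implicit Arguments.
Unset Strict Implicit.
Unset Printing Implicit Defensive.

Import Order.TTheory GRing.Theory Num.Theory.

Record sgraph := SGraph {
  vertex :> finType;
  adj : rel vertex;
  adj_sym : symmetric adj;
  adj_irr : irreflexive adj
}.

Section Graph.
Variable G : sgraph.

Definition induced (A : {set G}) : sgraph :=
  @SGraph {x : G | x \in A} (fun x y => adj (val x) (val y))
    (fun x y => adj_sym (val x) (val y)) (fun x => adj_irr (val x)).

Definition clique (A : {set G}) : bool :=
  [forall x in A, forall y in A, (x != y) ==> adj x y].

Definition clique_number : nat := \max_(A : {set G} | clique A) #|A|.

Definition colorable (k : nat) : bool :=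
  [exists f : {ffun G -> 'I_k},
     [forall x, forall y, adj x y ==> (f x != f y)]].

Lemma colorable_card : exists k, colorable k.
Proof.
exists #|G|; apply/existsP; exists [ffun x => enum_rank x].
apply/forallP => x; apply/forallP => y; apply/implyP => xy.
rewrite !ffunE (inj_eq enum_rank_inj); apply: contraTneq xy => ->.
by rewrite adj_irr.
Qed.

Definition chromatic_number : nat := ex_minn colorable_card.

End Graph.

(* [n] ranges over all integers; for [n < 0] there is no induced subgraph to
   consider and the maximum is 0. *)
Definition chi_upto (n : int) (G : sgraph) : nat :=
  \max_(A : {set G} | ((clique_number (induced A))%:Z <= n)%R)
     chromatic_number (induced A).

Definition iso (G H : sgraph) : Prop :=
  exists2 f : G -> H, bijective f & forall x y, adj (f x) (f y) = adj x y.

(* Not required to be closed under isomorphism. *)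
Definition graph_class := sgraph -> Prop.

Definition induced_free (H : sgraph) : graph_class :=
  fun G => forall A : {set G}, ~ iso (induced A) H.

Definition hereditary (F : graph_class) : Prop :=
  forall (G : sgraph) (A : {set G}), F G -> F (induced A).

Definition poly_chi_bounded (F : graph_class) : Prop :=
  exists f : {poly int}, forall (G : sgraph) (A : {set G}), F G ->
    ((chromatic_number (induced A))%:Z
       <= f.[(clique_number (induced A))%:Z])%R.

Definition good (n : int) (F : graph_class) : Prop :=
  hereditary F /\ exists c : nat, forall G, F G -> chi_upto n G <= c.

Definition strongly_pollyanna (n : int) (C : graph_class) : Prop :=
  forall F : graph_class, good n F ->
    poly_chi_bounded (fun G => C G /\ F G).

Section DisjointCliques.
Variables m t : nat.

Definition mK_adj : rel ('I_m * 'I_t) :=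
  fun x y => (x.1 == y.1) && (x.2 != y.2).

Lemma mK_sym : symmetric mK_adj.
Proof. by move=> x y; rewrite /mK_adj eq_sym [x.2 == _]eq_sym. Qed.

Lemma mK_irr : irreflexive mK_adj.
Proof. by move=> x; rewrite /mK_adj !eqxx. Qed.

Definition mK : sgraph := SGraph mK_sym mK_irr.

End DisjointCliques.

Section Pineapple.
Variables t k : nat.

(* All pendant edges are attached at vertex 0 of K_t. *)
Definition pineapple_adj : rel ('I_t + 'I_k) := fun x y =>
  match x, y with
  | inl i, inl j => i != j
  | inl i, inr _ | inr _, inl i => val i == 0
  | inr _, inr _ => false
  end.

Lemma pineapple_sym : symmetric pineapple_adj.
Proof. by case=> i [] j //=; rewrite eq_sym. Qed.

Lemma pineapple_irr : irreflexive pineapple_adj.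
Proof. by case=> i //=; rewrite eqxx. Qed.

Definition pineapple : sgraph := SGraph pineapple_sym pineapple_irr.

End Pineapple.

Section Lollipop.
Variable t : nat.

(* The edge added between K_t and P_2 joins vertex 0 of each. *)
Definition lollipop_adj : rel ('I_t + 'I_2) := fun x y =>
  match x, y with
  | inl i, inl j => i != j
  | inl i, inr j | inr j, inl i => (val i == 0) && (val j == 0)
  | inr i, inr j => i != j
  end.

Lemma lollipop_sym : symmetric lollipop_adj.
Proof. by case=> i [] j //=; rewrite eq_sym. Qed.

Lemma lollipop_irr : irreflexive lollipop_adj.
Proof. by case=> i //=; rewrite eqxx. Qed.

Definition lollipop : sgraph := SGraph lollipop_sym lollipop_irr.

End Lollipop.

Definition bowtie_adj : rel (option (mK 2 2)) := fun x y =>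
  match x, y with
  | Some u, Some v => adj u v
  | None, None => false
  | _, _ => true
  end.

Lemma bowtie_sym : symmetric bowtie_adj.
Proof. by case=> [u|] [v|] //=; apply: mK_sym. Qed.

Lemma bowtie_irr : irreflexive bowtie_adj.
Proof. by case=> [u|] //=; apply: mK_irr. Qed.

Definition bowtie : sgraph := SGraph bowtie_sym bowtie_irr.

(* a, b, c, d, e are 0, 1, 2, 3, 4. *)
Definition bull_edges : seq (nat * nat) :=
  [:: (0, 1); (0, 2); (1, 2); (0, 3); (1, 4)].

Definition bull_adj : rel 'I_5 := fun x y =>
  ((val x, val y) \in bull_edges) || ((val y, val x) \in bull_edges).

Lemma bull_sym : symmetric bull_adj.
Proof. by move=> x y; rewrite /bull_adj orbC. Qed.

Lemma bull_irr : irreflexive bull_adj.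
Proof. by case; do 5?[case=> //]. Qed.

Definition bull : sgraph := SGraph bull_sym bull_irr.

(* Main.v *)
Require Import Defs.
From mathcomp Require Import all_boot all_order all_algebra.
From mathcomp Require Import zify.

Set Implicit Arguments.
Unset Strict Implicit.
Unset Printing Implicit Defensive.

Import Order.TTheory GRing.Theory Num.Theory.

(** Fix a maximum clique [K]; every vertex has a non-neighbour in [K].

    (i) Vertices with at least [t] non-neighbours in [K] miss a [t]-subset of
    [K], so induction on [m] applies to them; the others are grouped by their
    fewer than [t] non-neighbours, and each group has clique number below [t].

    (ii), (iv) Neighbourhoods are coloured by (i).  One repeatedly removes a
    suitable set [B] around a small clique, so that a vertex of [B] has few
    (pineapple) or only pairwise non-adjacent (bowtie) neighbours left; the
    colourings of the successive [B]'s can then be combined.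

    (iii) If there are two anticomplete large cliques [K] and [C], with [K] as
    large as possible, the set [X] of vertices with a neighbour in each is
    complete to [K] and nothing outside [X] has a clique larger than [K]; thus
    [omega X + omega (A :\: X) <= omega A] and a superadditive bound follows by
    induction.  Otherwise (i) applies with [m = 2].

    (v) Polynomial bounds survive substitution, so the graph may be assumed
    prime.  In a prime bull-free graph a set with adjacent centre and
    anticentre has only split graphs as prime induced subgraphs.  The sets of
    non-neighbours in [K] take polynomially many values, which bounds the
    chromatic number of the vertices touching [K].  Remove these and iterate:
    vertices with the same colour and the same size of [K] span no triangle. *)

Lemma leq_expn2r a b e : a <= b -> a ^ e <= b ^ e.
Proof. by case: e => [|e] ab; rewrite ?expn0 ?leq_exp2r. Qed.

Lemma leq_expD a b e : 0 < e -> a ^ e + b ^ e <= (a + b) ^ e.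
Proof.
case: e => // e _; rewrite !expnS mulnDl leq_add // leq_mul // leq_expn2r //.
  exact: leq_addr.
exact: leq_addl.
Qed.

Lemma leq_sum_const (I : finType) (P : {set I}) (F : I -> nat) a :
  {in P, forall i, F i <= a} -> \sum_(i in P) F i <= #|P| * a.
Proof. by move=> Fa; rewrite -sum_nat_const leq_sum. Qed.

Lemma exists_ltn_notin (s : seq nat) n : size s < n ->
  exists2 d, d < n & d \notin s.
Proof.
move=> sn; have [/allP sub|/allPn[d]] := boolP (all [in s] (iota 0 n)).
  by have := uniq_leq_size (iota_uniq 0 n) sub; rewrite size_iota leqNgt sn.
by rewrite mem_iota add0n; exists d.
Qed.

Lemma split_last_not (T : Type) (p : pred T) (l : seq T) : ~~ all p l ->
  exists z l1 l2, [/\ l = l1 ++ z :: l2, ~~ p z & all p l2].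
Proof.
elim: l => [//|z l IHl]; have [l_p|l_np] := boolP (all p l).
  by rewrite /= l_p andbT => zp; exists z, [::], l.
move=> _; have [y [l1 [l2 [-> yp l2p]]]] := IHl l_np.
by exists y, (z :: l1), l2.
Qed.

Section FiniteSets.
Variable T : finType.
Implicit Types A B K : {set T}.

Lemma proper_set_ind (P : {set T} -> Prop) :
  (forall A, (forall B, B \proper A -> P B) -> P A) -> forall A, P A.
Proof.
move=> IH A; have [n] := ubnP #|A|; elim: n A => // n IHn A; rewrite ltnS => An.
by apply: IH => B /proper_card BA; apply: IHn; apply: leq_trans An.
Qed.

Lemma properDI A B x : x \in A -> x \in B -> A :\: B \proper A.
Proof.
move=> xA xB; apply/properP; split; first exact: subsetDl.
by exists x; rewrite // inE xB.
Qed.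

Lemma setId_sub A (P : pred T) : [set x in A | P x] \subset A.
Proof. by rewrite setIdE subsetIl. Qed.

Lemma setUDK A B : A \subset B -> A :|: B :\: A = B.
Proof. by move=> AB; rewrite -{1}(setIidPr AB) setID. Qed.

Lemma exists_subset_card A n : n <= #|A| ->
  exists2 B : {set T}, B \subset A & #|B| = n.
Proof.
case/card_geqP => s [s_uniq <- sA]; exists [set x in s].
  by apply/subsetP => x; rewrite inE => /sA.
by rewrite cardsE (card_uniqP s_uniq).
Qed.

Lemma exists_ord_injection A n : #|A| = n ->
  exists2 g : 'I_n -> T, injective g & forall i, g i \in A.
Proof.
move=> An; exists (fun i => enum_val (cast_ord (esym An) i)); last first.
  by move=> i; apply: enum_valP.
by move=> i j /enum_val_inj/cast_ord_inj.
Qed.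

Lemma card_bigcup_leq (I : finType) (P : pred I) (F : I -> {set T}) :
  #|\bigcup_(i | P i) F i| <= \sum_(i | P i) #|F i|.
Proof.
elim/big_rec2: _ => [|i n B _ Bn]; first by rewrite cards0.
by rewrite cardsU (leq_trans (leq_subr _ _)) // leq_add2l.
Qed.

(* Such a set is the range of a partial function on ['I_t]. *)
Lemma card_subsets_leq K t :
  #|[set S : {set T} | (S \subset K) && (#|S| <= t)]| <= #|K|.+1 ^ t.
Proof.
pose P := None |: [set Some x | x in K].
have cardP : #|P| = #|K|.+1.
  rewrite cardsU1 card_imset; last by move=> x y [].
  by have /negPf-> : None \notin [set Some x | x in K] by apply/imsetP => -[].
pose range (f : {ffun 'I_t -> option T}) := [set x | Some x \in codom f].
rewrite -cardP -[t in X in _ <= X]card_ord -card_ffun_on.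
apply: leq_trans (leq_imset_card range _); apply/subset_leq_card/subsetP => S.
rewrite inE => /andP[SK St]; pose s := [seq Some x | x <- enum S].
have size_s : size s = #|S| by rewrite size_map -cardE.
apply/imsetP; exists [ffun i : 'I_t => nth None s i].
  apply/ffun_onP => i; rewrite ffunE.
  have [si|si] := leqP (size s) i; first by rewrite nth_default // setU11.
  have /mapP[x xS ->] := mem_nth None si; rewrite mem_enum in xS.
  by rewrite setU1r // imset_f // (subsetP SK).
apply/setP => x; rewrite inE; apply/idP/codomP => [xS|[i]].
  have /(nthP None)[i si si_x] : Some x \in s by rewrite map_f // mem_enum.
  have it : i < t by rewrite (leq_trans si) // size_s.
  by exists (Ordinal it); rewrite ffunE.
rewrite ffunE => x_i.
have [si|si] := leqP (size s) i; first by rewrite nth_default in x_i.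
by have := mem_nth None si; rewrite -x_i => /mapP[y yS [->]]; rewrite -mem_enum.
Qed.
End FiniteSets.

Lemma cliqueP (G : sgraph) (A : {set G}) :
  reflect {in A &, forall x y, x != y -> adj x y} (clique A).
Proof.
apply: (iffP forall_inP) => [cA x y xA yA xy|cA x xA].
  by have /forall_inP/(_ y yA)/implyP := cA x xA; apply.
by apply/forall_inP => y yA; apply/implyP; apply: cA.
Qed.

Section CliquesAndColourings.
Variable G : sgraph.
Implicit Types (x y z u v : G) (A B I K L S T : {set G}).

Definition stable A : bool := [forall x in A, forall y in A, ~~ adj x y].

Definition omega A : nat := clique_number (induced A).

Definition chi A : nat := chromatic_number (induced A).

Definition maximum_clique A K : Prop :=
  [/\ K \subset A, clique K & #|K| = omega A].

Definition proper_colouring A (n : nat) (f : G -> nat) : Prop :=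
  {in A, forall x, f x < n} /\ {in A &, forall x y, adj x y -> f x <> f y}.

Definition omega_lt_chi_leq (q c : nat) : Prop :=
  forall A, omega A < q -> chi A <= c.

Definition nbrs A x : {set G} := [set u in A | adj x u].

Definition non_nbrs A x : {set G} := [set u in A | ~~ adj x u].

Definition touches A x : bool := [exists u in A, adj x u].

Definition closed_nbhd A K : {set G} := K :|: [set x in A | touches K x].

Definition complete_to A x : Prop := {in A, forall u, adj x u}.

Definition anticomplete_to A x : Prop := {in A, forall u, ~~ adj x u}.

Definition complete A B : Prop := {in A & B, forall x y, adj x y}.

Definition anticomplete A B : Prop := {in A & B, forall x y, ~~ adj x y}.

Definition anti_nbhd S : {set G} := [set x | (x \notin S) && ~~ touches S x].

Lemma adj_neq x y : adj x y -> x != y.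
Proof. by apply: contraTneq => ->; rewrite adj_irr. Qed.

Lemma stableP A : reflect {in A &, forall x y, ~~ adj x y} (stable A).
Proof.
apply: (iffP forall_inP) => [sA x y xA|sA x xA].
  exact: (forall_inP (sA x xA)).
by apply/forall_inP => y yA; apply: sA.
Qed.

Lemma cliqueS A B : A \subset B -> clique B -> clique A.
Proof.
move=> /subsetP AB /cliqueP cB; apply/cliqueP => x y /AB xB /AB yB.
exact: cB.
Qed.

Lemma stableS A B : A \subset B -> stable B -> stable A.
Proof.
move=> /subsetP AB /stableP sB; apply/stableP => x y /AB xB /AB yB.
exact: sB.
Qed.

Lemma clique0 : clique (set0 : {set G}).
Proof. by apply/cliqueP => x y; rewrite inE. Qed.

Lemma clique1 x : clique [set x].
Proof. by apply/cliqueP => y z /set1P-> /set1P->; rewrite eqxx. Qed.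

Lemma cliqueU A B :
  clique A -> clique B -> complete A B -> clique (A :|: B).
Proof.
move=> /cliqueP cA /cliqueP cB AB.
apply/cliqueP => x y /setUP[] xA /setUP[] yA xy.
- exact: cA.
- exact: AB.
- by rewrite adj_sym; apply: AB.
- exact: cB.
Qed.

Lemma cliqueU1 x K : clique K -> complete_to K x -> clique (x |: K).
Proof.
by move=> cK xK; apply: cliqueU (clique1 x) cK _ => _ u /set1P->; apply: xK.
Qed.

Lemma clique2 x y : adj x y -> clique [set x; y].
Proof. by move=> xy; apply: cliqueU1 (clique1 y) _ => _ /set1P->. Qed.

Lemma leq_omega A K : K \subset A -> clique K -> #|K| <= omega A.
Proof.
move=> /subsetP KA /cliqueP cK.
have -> : K = val @: [set u : induced A | val u \in K].
  apply/setP => x; apply/idP/imsetP => [xK|[u]]; last by rewrite inE => ? ->.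
  by exists (Sub x (KA x xK)); rewrite ?inE.
rewrite card_imset; last exact: val_inj.
apply: (@leq_bigmax_cond _ _ (fun K : {set induced A} => #|K|)).
by apply/cliqueP => u v; rewrite !inE -(inj_eq val_inj); apply: cK.
Qed.

Lemma exists_maximum_clique A : exists K, maximum_clique A K.
Proof.
have P0 : clique (set0 : {set induced A}) by apply/cliqueP => x y; rewrite inE.
rewrite /maximum_clique /omega /clique_number (bigop.bigmax_eq_arg set0) //.
case: arg_maxnP => // K /cliqueP cK _.
exists (val @: K); split; last by rewrite card_imset //; apply: val_inj.
  by apply/subsetP => _ /imsetP[u _ ->]; apply: valP.
apply/cliqueP => _ _ /imsetP[u uK ->] /imsetP[v vK ->].
by rewrite (inj_eq val_inj); apply: cK.
Qed.

Lemma omega_leP A n :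
  reflect (forall K, K \subset A -> clique K -> #|K| <= n) (omega A <= n).
Proof.
apply: (iffP idP) => [An K KA cK|Kn].
  exact: leq_trans (leq_omega KA cK) An.
by have [K [KA cK <-]] := exists_maximum_clique A; apply: Kn.
Qed.

Lemma exists_clique_card A n : n <= omega A ->
  exists K, [/\ K \subset A, clique K & #|K| = n].
Proof.
have [L [LA cL <-]] := exists_maximum_clique A.
move=> /exists_subset_card[K KL Kn].
by exists K; rewrite (subset_trans KL) // (cliqueS KL).
Qed.

Lemma omegaS A B : A \subset B -> omega A <= omega B.
Proof.
by move=> AB; apply/omega_leP => K KA; apply: leq_omega; apply: subset_trans AB.
Qed.

Lemma omega_gt0 A x : x \in A -> 0 < omega A.
Proof. by move=> xA; rewrite -(cards1 x) leq_omega ?sub1set ?clique1. Qed.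

Lemma omega_eq0 A : omega A = 0 -> A = set0.
Proof. by move=> A0; apply/eqP/set0Pn => -[x /omega_gt0]; rewrite A0. Qed.

Lemma omega_clique K : clique K -> omega K = #|K|.
Proof.
move=> cK; apply/eqP; rewrite eqn_leq leq_omega // andbT.
by apply/omega_leP => L LK _; apply: subset_leq_card.
Qed.

Lemma omegaU_complete A B :
  complete A B -> omega A + omega B <= omega (A :|: B).
Proof.
move=> AB; have [K [KA cK <-]] := exists_maximum_clique A.
have [L [LB cL <-]] := exists_maximum_clique B.
have KL : complete K L.
  by move=> x y /(subsetP KA) xA /(subsetP LB); apply: AB.
have disj : [disjoint K & L].
  apply/pred0P => x; apply/negP => /= /andP[xK xL].
  by have := KL x x xK xL; rewrite adj_irr.
move: disj; rewrite -leq_card_setU => /eqP <-.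
by rewrite leq_omega ?setUSS // cliqueU.
Qed.

Lemma omega_leq1_stable A : omega A <= 1 -> stable A.
Proof.
move=> A1; apply/stableP => x y xA yA; apply/negP => xy.
have := leq_trans (leq_omega (_ : [set x; y] \subset A) (clique2 xy)) A1.
by rewrite cards2 (adj_neq xy) subUset !sub1set xA yA => /(_ isT).
Qed.

Lemma chiP A n : reflect (exists f, proper_colouring A n f) (chi A <= n).
Proof.
rewrite /chi /chromatic_number; case: ex_minnP => m m_col min_m.
apply: (iffP idP) => [mn|[g [gn gP]]].
  have /existsP[f /forallP fP] := m_col.
  exists (fun x => if insub x is Some u then val (f u) else 0).
  split=> [x xA|x y xA yA xy].
    by rewrite insubT /=; apply: leq_trans mn.
  rewrite !insubT /= => /val_inj fxy.
  have /forallP/(_ (Sub y yA))/implyP/(_ xy) := fP (Sub x xA).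
  by rewrite fxy eqxx.
apply: min_m; apply/existsP.
exists [ffun u : induced A => Ordinal (gn (val u) (valP u))].
apply/forallP => x; apply/forallP => y; apply/implyP => xy; rewrite !ffunE.
by apply/eqP => /(congr1 val) /=; apply: gP xy; apply: valP.
Qed.

Lemma chi_colouring A : exists f, proper_colouring A (chi A) f.
Proof. exact/chiP. Qed.

Lemma chiS A B : A \subset B -> chi A <= chi B.
Proof.
move=> /subsetP AB; have [f [fB fP]] := chi_colouring B.
by apply/chiP; exists f; split=> [x /AB/fB|x y /AB xB /AB]; last apply: fP.
Qed.

Lemma chi0 : chi set0 = 0.
Proof.
apply/eqP; rewrite -leqn0; apply/chiP; exists (fun=> 0).
by split=> x; rewrite inE.
Qed.

Lemma chi_leq_card A : chi A <= #|A|.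
Proof.
apply/chiP; exists (fun x => index x (enum A)); split=> [x xA|x y xA yA xy].
  by rewrite cardE index_mem mem_enum.
move=> /(congr1 (nth x (enum A))); rewrite !nth_index ?mem_enum // => e.
by move: xy; rewrite e adj_irr.
Qed.

Lemma chi_stable A : stable A -> chi A <= 1.
Proof.
move=> /stableP sA; apply/chiP; exists (fun=> 0); split=> // x y xA yA xy.
by rewrite (negPf (sA x y xA yA)) in xy.
Qed.

Lemma chiU A B : chi (A :|: B) <= chi A + chi B.
Proof.
have [f [fA fP]] := chi_colouring A; have [g [gB gP]] := chi_colouring B.
have f_neq_g x n : x \in A -> f x <> chi A + n.
  by move=> /fA fx e; rewrite e ltnNge leq_addr in fx.
apply/chiP; exists (fun x => if x \in A then f x else chi A + g x).
split=> [x|x y]; rewrite !inE.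
  by case: ifP => [xA _|_ /= xB]; [apply/ltn_addr/fA|rewrite ltn_add2l gB].
case: ifP => xA; case: ifP => yA //= xB yB.
- exact: fP.
- by move=> _; apply: f_neq_g.
- by move=> _ /esym; apply: f_neq_g.
- by move=> xy /addnI; apply: gP.
Qed.

Lemma chi_setID A B : chi A <= chi (A :&: B) + chi (A :\: B).
Proof. by rewrite -{1}(setID A B) chiU. Qed.

Lemma chiU_anticomplete A B : anticomplete A B ->
  chi (A :|: B) <= maxn (chi A) (chi B).
Proof.
move=> AB.
have [f [fA fP]] := chi_colouring A; have [g [gB gP]] := chi_colouring B.
apply/chiP; exists (fun x => if x \in A then f x else g x).
split=> [x|x y]; rewrite !inE.
  by rewrite leq_max; case: ifP => [xA _|_ /= xB]; rewrite ?fA ?gB ?orbT.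
case: ifP => xA; case: ifP => yA //= xB yB.
- exact: fP.
- by rewrite (negPf (AB _ _ xA yB)).
- by rewrite adj_sym (negPf (AB _ _ yA xB)).
- exact: gP.
Qed.

Lemma chi_bigcup (J : finType) (P : pred J) (F : J -> {set G}) :
  chi (\bigcup_(i | P i) F i) <= \sum_(i | P i) chi (F i).
Proof.
elim/big_rec2: _ => [|i n B _ Bn]; first by rewrite chi0.
by apply: leq_trans (chiU _ _) _; rewrite leq_add2l.
Qed.

Lemma chi_classes (C : eqType) (g : G -> C) (s : seq C) A c :
  {in A, forall x, g x \in s} -> (forall i, chi [set x in A | g x == i] <= c) ->
  chi A <= size s * c.
Proof.
move=> gs gc; have -> : A = [set x in A | g x \in s].
  by apply/setP => x; rewrite inE; apply/idP/andP => [xA|[]] //; rewrite gs.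
elim: {gs} s => [|i s IHs].
  have -> : [set x in A | g x \in [::]] = set0.
    by apply/setP => x; rewrite !inE andbF.
  by rewrite chi0.
have -> : [set x in A | g x \in i :: s] =
    [set x in A | g x == i] :|: [set x in A | g x \in s].
  by apply/setP => x; rewrite !inE -andb_orr.
by apply: leq_trans (chiU _ _) _; rewrite mulSn leq_add.
Qed.

Lemma card_leq_chi A a : (forall I, I \subset A -> stable I -> #|I| <= a) ->
  #|A| <= chi A * a.
Proof.
have [f [fA fP]] := chi_colouring A => small.
have AF : A \subset \bigcup_(i : 'I_(chi A)) [set x in A | f x == i].
  apply/subsetP => x xA; apply/bigcupP; exists (Ordinal (fA x xA)) => //.
  by rewrite inE xA /=.
apply: leq_trans (subset_leq_card AF) (leq_trans (card_bigcup_leq _ _) _).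
rewrite -[X in _ <= X * a]card_ord -sum_nat_const.
apply: leq_sum => i _; apply: small.
  exact: setId_sub.
apply/stableP => x y; rewrite !inE => /andP[xA /eqP fx] /andP[yA /eqP fy].
by apply/negP => /(fP x y xA yA); rewrite fx fy.
Qed.

Lemma omega_lt_chi_leqW p q c : p <= q -> omega_lt_chi_leq q c ->
  omega_lt_chi_leq p c.
Proof. by move=> pq cq A Ap; apply: cq; apply: leq_trans pq. Qed.

Lemma in_nbrs A x u : (u \in nbrs A x) = (u \in A) && adj x u.
Proof. by rewrite inE. Qed.

Lemma nbrs_sub A x : nbrs A x \subset A.
Proof. exact: setId_sub. Qed.

Lemma non_nbrs_sub A x : non_nbrs A x \subset A.
Proof. exact: setId_sub. Qed.

Lemma card_nbrs A x : #|nbrs A x| + #|non_nbrs A x| = #|A|.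
Proof.
rewrite -(cardsID (nbrs A x) A) (setIidPr (nbrs_sub A x)).
congr (_ + #|pred_of_set _|).
by apply/setP => u; rewrite !inE; case: (u \in A); rewrite ?andbF ?andbT.
Qed.

Lemma touchesPn A x : reflect (anticomplete_to A x) (~~ touches A x).
Proof. by rewrite negb_exists_in; apply: forall_inP. Qed.

Lemma touches_non_nbrs K x : touches K x = (non_nbrs K x != K).
Proof.
apply/idP/idP => [/exists_inP[u uK xu]|].
  by apply/eqP => e; move: uK; rewrite -e inE xu andbF.
apply: contraR => /touchesPn nK; rewrite eqEsubset non_nbrs_sub.
by apply/subsetP => u uK; rewrite inE uK nK.
Qed.

Lemma closed_nbhd_sub A K : K \subset A -> closed_nbhd A K \subset A.
Proof. by rewrite subUset => ->; apply: setId_sub. Qed.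

Lemma chi_closed_nbhd A K n : {in K, forall v, chi (nbrs A v) <= n} ->
  chi (closed_nbhd A K) <= #|K| + #|K| * n.
Proof.
move=> chi_n.
have sub : [set x in A | touches K x] \subset \bigcup_(v in K) nbrs A v.
  apply/subsetP => x; rewrite inE => /andP[xA /exists_inP[v vK xv]].
  by apply/bigcupP; exists v; rewrite // inE xA adj_sym.
apply: leq_trans (chiU _ _) (leq_add (chi_leq_card _) _).
apply: leq_trans (chiS sub) (leq_trans (chi_bigcup _ _) _).
exact: leq_sum_const.
Qed.

Lemma anti_nbhdP S x :
  reflect (x \notin S /\ anticomplete_to S x) (x \in anti_nbhd S).
Proof. by rewrite inE; apply: (iffP andP) => -[xS /touchesPn]. Qed.

Lemma maximum_clique_non_nbr A K x : maximum_clique A K -> x \in A ->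
  exists2 u, u \in K & ~~ adj x u.
Proof.
move=> [KA cK Kw] xA.
have [/exists_inP //|] := boolP [exists u in K, ~~ adj x u].
rewrite negb_exists_in => /forall_inP xK; exfalso.
have {}xK : complete_to K x by move=> u /xK; rewrite negbK.
have xnK : x \notin K by apply/negP => /xK; rewrite adj_irr.
have := leq_omega (_ : x |: K \subset A) (cliqueU1 cK xK).
by rewrite cardsU1 xnK Kw ltnn subUset sub1set xA => /(_ KA).
Qed.

Lemma exists_complete_subclique K x s : clique K -> (2 * s).-1 <= #|K| ->
  #|non_nbrs K x| < s ->
  exists T, [/\ T \subset K, clique T, #|T| = s & complete_to T x].
Proof.
move=> cK Ks xs; have /exists_subset_card[T TN Ts] : s <= #|nbrs K x|.
  by have := card_nbrs K x; lia.
have TK := subset_trans TN (nbrs_sub K x).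
exists T; split=> //; first exact: cliqueS cK.
by move=> u /(subsetP TN); rewrite inE => /andP[].
Qed.

Lemma clique_embedding K n : clique K -> #|K| = n -> exists g : 'I_n -> G,
  (forall i, g i \in K) /\ (forall i j, adj (g i) (g j) = (i != j)).
Proof.
move=> /cliqueP cK /exists_ord_injection[g g_inj gK]; exists g; split=> // i j.
have [->|ij] := eqVneq i j; first by rewrite adj_irr.
by rewrite cK // (inj_eq g_inj).
Qed.

Lemma clique_embedding_inj (J : eqType) (g : J -> G) :
  (forall i j, adj (g i) (g j) = (i != j)) -> injective g.
Proof.
by move=> g_adj i j gij; apply/eqP/negbFE; rewrite -g_adj gij adj_irr.
Qed.

Lemma pointed_clique_embedding T v n :
  clique T -> #|T| = n -> complete_to T v ->
  exists g : 'I_n.+1 -> G, [/\ g ord0 = v, forall i, i != ord0 -> g i \in T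
    & forall i j, adj (g i) (g j) = (i != j)].
Proof.
move=> cT /(clique_embedding cT)[g [gT g_adj]] vT.
exists (fun i => if unlift ord0 i is Some j then g j else v); split=> [|i|i j].
- by rewrite unlift_none.
- by case: unliftP => [j _|->]; rewrite ?gT ?eqxx.
case: unliftP => [i' ->|->]; case: unliftP => [j' ->|->].
- by rewrite (inj_eq lift_inj) g_adj.
- by rewrite adj_sym vT // eq_sym neq_lift.
- by rewrite vT // neq_lift.
- by rewrite adj_irr eqxx.
Qed.
End CliquesAndColourings.

Section InducedFree.
Variables G H : sgraph.
Implicit Types f : H -> G.

Lemma induced_free_no_embedding f : induced_free H G ->
  {mono f : x y / adj x y} -> injective f -> False.
Proof.
move=> free f_adj f_inj; apply: (free (f @: setT)).
have imf (u : induced (f @: setT)) : val u \in codom f.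
  by have /imsetP[x _ ->] := valP u; apply: codom_f.
pose g (u : induced (f @: setT)) := iinv (imf u).
have fg u : f (g u) = val u by rewrite /g f_iinv.
exists g => [|x y]; last by rewrite -f_adj !fg.
exists (fun x => Sub (f x) (imset_f f (in_setT x))) => [u|x].
  by apply: val_inj; rewrite /= fg.
by apply: f_inj; rewrite fg.
Qed.

Lemma no_false_twins_mono_inj f : (forall x y : H, adj x =1 adj y -> x = y) ->
  {mono f : x y / adj x y} -> injective f.
Proof. by move=> twin f_adj x y fxy; apply: twin => z; rewrite -!f_adj fxy. Qed.
End InducedFree.

(* The premise excludes [q <= 1], for which only the empty set qualifies. *)
Lemma good_omega_lt_chi_leq n q F : (1 < q -> (q%:Z <= n + 1)%R) -> good n F ->
  exists c, forall G, F G -> omega_lt_chi_leq G q c.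
Proof.
move=> qn [_ [c Fc]]; exists c => G FG A Aq; have [q1|q1] := leqP q 1.
  by rewrite (@omega_eq0 _ A) ?chi0 //; lia.
apply: leq_trans (Fc G FG).
apply: (@leq_bigmax_cond _ _ (fun A : {set G} => chromatic_number (induced A))).
by rewrite -/(omega A); have := qn q1; lia.
Qed.

Lemma poly_chi_bounded_monomial (F : graph_class) C e :
  (forall G, F G -> forall A : {set G}, chi A <= C * (omega A).+1 ^ e) ->
  poly_chi_bounded F.
Proof.
move=> chiF; exists (C%:R%:P * ('X + 1) ^+ e)%R => G A FG.
rewrite hornerM horner_exp hornerD hornerX !hornerC.
apply: (@le_trans _ _ (C * (omega A).+1 ^ e)%N%:Z%R).
  by rewrite lez_nat chiF.
by rewrite PoszM -!natz natrX -natr1.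
Qed.

(** * Disjoint unions of cliques *)

Section DisjointCliques.
Variable G : sgraph.
Implicit Types (x y z u : G) (A B I K L S : {set G}).

Fixpoint has_mK (t m : nat) A : Prop :=
  if m is m'.+1 then
    exists S, [/\ S \subset A, clique S, #|S| = t
      & has_mK t m' (A :&: anti_nbhd S)]
  else True.

Lemma omega_non_nbrs_class A K S : maximum_clique A K ->
  omega [set x in A | non_nbrs K x == S] <= #|S|.
Proof.
move=> [KA cK Kw]; apply/omega_leP => L /subsetP LS cL.
have LP x : x \in L -> x \in A /\ non_nbrs K x = S.
  by move=> /LS; rewrite inE => /andP[xA /eqP].
have LK : complete L (K :\: S).
  by move=> x u /LP[_ <-] /setDP[uK]; rewrite inE uK negbK.
have cKS : clique (K :\: S) by apply: cliqueS cK; apply: subsetDl.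
have LKA : L :|: K :\: S \subset A.
  rewrite subUset (subset_trans (subsetDl _ _) KA) andbT.
  by apply/subsetP => x /LP[].
have := leq_trans (omegaU_complete LK) (omegaS LKA).
rewrite -Kw !omega_clique // cardsD.
have := subset_leq_card (subsetIl K S).
by have := subset_leq_card (subsetIr K S); lia.
Qed.

(* A vertex outside [K] either misses a [t]-subset of [K], or has fewer than
   [t] non-neighbours in [K]. *)
Lemma chi_cover_by_non_nbrs A K t M :
  (forall S, S \subset K -> #|S| = t -> chi (A :&: anti_nbhd S) <= M) ->
  (forall S, S \subset K -> #|S| < t ->
    chi [set x in A | non_nbrs K x == S] <= M) ->
  chi A <= #|K| + #|K|.+1 ^ t * M.
Proof.
move=> chi_miss chi_few.
pose small := [set S : {set G} | (S \subset K) && (#|S| <= t)].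
pose F S :=
  if #|S| == t then A :&: anti_nbhd S else [set x in A | non_nbrs K x == S].
have chiF : {in small, forall S, chi (F S) <= M}.
  move=> S; rewrite inE => /andP[SK St]; rewrite /F; case: eqP => [|/eqP St'].
    exact: chi_miss.
  by apply: chi_few; rewrite // ltn_neqAle St'.
have AF : A \subset K :|: \bigcup_(S in small) F S.
  apply/subsetP => x xA; rewrite inE; have [//|xK /=] := boolP (x \in K).
  apply/bigcupP.
  have [few|/exists_subset_card[S SN St]] := ltnP #|non_nbrs K x| t.
    exists (non_nbrs K x); first by rewrite inE non_nbrs_sub ltnW.
    by rewrite /F ltn_eqF // inE xA /=.
  have SK := subset_trans SN (non_nbrs_sub K x).
  exists S; first by rewrite inE SK St leqnn.
  rewrite /F St eqxx inE xA; apply/anti_nbhdP; split.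
    by apply: contra xK => /(subsetP SK).
  by move=> u /(subsetP SN); rewrite inE => /andP[].
apply: leq_trans (chiS AF) (leq_trans (chiU _ _) _).
rewrite leq_add ?chi_leq_card //; apply: leq_trans (chi_bigcup _ _) _.
by apply: leq_trans (leq_sum_const chiF) _; rewrite leq_mul ?card_subsets_leq.
Qed.

Lemma chi_mK_free t c : 0 < t -> omega_lt_chi_leq G t c -> forall m A,
  ~ has_mK t m A -> chi A <= m * c.+1 * (omega A).+1 ^ (t * m).
Proof.
move=> t0 chi_c; elim=> [A []//|m IHm A A_free].
have [K maxK] := exists_maximum_clique A; have [KA cK Kw] := maxK.
have := @chi_cover_by_non_nbrs A K t (m * c.+1 * (omega A).+1 ^ (t * m) + c).
rewrite Kw => bound; apply: leq_trans (bound _ _) _ => [S SK St|S SK St|].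
- apply: leq_trans (leq_addr _ _).
  apply: leq_trans (IHm (A :&: anti_nbhd S) _) _.
    move=> S_mK; apply: A_free; exists S.
    by split=> //; [apply: subset_trans KA|apply: cliqueS cK].
  by rewrite leq_mul // leq_expn2r // ltnS omegaS // subsetIl.
- apply: leq_trans (leq_addl _ _); apply: chi_c.
  exact: leq_ltn_trans (omega_non_nbrs_class S maxK) St.
have wt : omega A <= (omega A).+1 ^ t.
  by apply: leq_trans (leqnSn _) _; rewrite -{1}(expn1 (omega A).+1) leq_pexp2l.
have : 0 < (omega A).+1 ^ (t * m) by rewrite expn_gt0.
rewrite [t * m.+1]mulnS expnD; move: wt.
move: (_ ^ t) (_ ^ (t * m)) => a b; nia.
Qed.

Lemma has_mK_stable t m A : 0 < t -> has_mK t m A ->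
  exists I, [/\ I \subset A, stable I & #|I| = m].
Proof.
move=> t0; elim: m A => [|m IHm] A /=.
  move=> _; exists set0; rewrite sub0set cards0.
  by split=> //; apply/stableP => x y; rewrite inE.
move=> [S [SA cS St /IHm[I [IA /stableP sI Im]]]].
have /card_gt0P[u uS] : 0 < #|S| by rewrite St.
have uI x : x \in I -> x \notin S /\ ~~ adj x u.
  by move=> /(subsetP IA)/setIP[_ /anti_nbhdP[xS /(_ u uS)]].
exists (u |: I); split.
- by rewrite subUset sub1set (subsetP SA) // (subset_trans IA) // subsetIl.
- apply/stableP => x y /setU1P[->|xI] /setU1P[->|yI]; rewrite ?adj_irr //.
  + by rewrite adj_sym; case: (uI y yI).
  + by case: (uI x xI).
  + exact: sI.
- rewrite cardsU1 Im; suff -> : u \notin I by [].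
  by apply/negP => /uI[/negP].
Qed.

Lemma card_leq_no_stable k A :
  (forall I, I \subset A -> stable I -> #|I| <> k) ->
  #|A| <= k * (omega A).+1 ^ k * k.
Proof.
move=> no_stable; have chi_0 : omega_lt_chi_leq G 1 0.
  by move=> B; rewrite ltnS leqn0 => /eqP/omega_eq0->; rewrite chi0.
have A_free : ~ has_mK 1 k A.
  by move=> /has_mK_stable[] // I [IA sI]; apply: no_stable.
have := chi_mK_free (ltn0Sn 0) chi_0 A_free; rewrite muln1 mul1n => chiA.
apply: leq_trans (@card_leq_chi G A k _) _ => [I IA sI|]; last first.
  by rewrite leq_mul.
rewrite leqNgt; apply/negP => /ltnW/exists_subset_card[J JI].
by apply: no_stable; [apply: subset_trans IA|apply: stableS sI].
Qed.

Lemma has_mK_embedding t m A : has_mK t m A -> exists f : mK m t -> G,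
  [/\ forall p, f p \in A, injective f & {mono f : p q / adj p q}].
Proof.
elim: m A => [|m IHm] A /=.
  move=> _; have no (p : mK 0 t) : False by case: p => -[].
  by exists (fun p => match no p with end); split=> p; case: (no p).
move=> [S [SA cS St /IHm[f [fA f_inj f_adj]]]].
have [g [gS g_adj]] := clique_embedding cS St.
have f_out p : f p \notin S /\ anticomplete_to S (f p).
  by have /setIP[_ /anti_nbhdP] := fA p.
pose h p := if unlift ord0 p.1 is Some i then f (i, p.2) else g p.2.
exists h; rewrite {}/h; split.
- move=> [i j] /=; case: unliftP => [k _|_]; last exact: (subsetP SA).
  by have /setIP[] := fA (k, j).
- move=> [i j] [i' j'] /=.
  case: unliftP => [k ->|->]; case: unliftP => [k' ->|->].
  + by move/f_inj => [-> ->].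
  + by move=> fg; have [] := f_out (k, j); rewrite fg gS.
  + by move=> gf; have [] := f_out (k', j'); rewrite -gf gS.
  + by move/(clique_embedding_inj g_adj) ->.
- move=> [i j] [i' j'] /=; rewrite /mK_adj /=.
  case: unliftP => [k ->|->]; case: unliftP => [k' ->|->];
    rewrite ?eqxx ?g_adj //.
  + rewrite eq_sym (negPf (neq_lift _ _)).
    by have [_ /(_ _ (gS j'))/negPf] := f_out (k, j).
  + rewrite (negPf (neq_lift _ _)) adj_sym.
    by have [_ /(_ _ (gS j))/negPf] := f_out (k', j').
Qed.

Lemma induced_free_mK m t A : induced_free (mK m t) G -> ~ has_mK t m A.
Proof.
move=> free /has_mK_embedding[f [_ f_inj f_adj]].
exact: induced_free_no_embedding free f_adj f_inj.
Qed.
End DisjointCliques.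

Lemma strongly_pollyanna_mK m t : 0 < t ->
  strongly_pollyanna (t%:Z - 1)%R (induced_free (mK m t)).
Proof.
move=> t0 F /(@good_omega_lt_chi_leq _ t)[|c chi_c]; first by lia.
apply: (@poly_chi_bounded_monomial _ (m * c.+1) (t * m)) => G [free FG] A.
by apply: chi_mK_free t0 (chi_c G FG) _ _ _; apply: induced_free_mK.
Qed.

(** * Pineapples *)

Section Peeling.
Variable G : sgraph.
Implicit Types (x y : G) (A B R U W : {set G}).

(* A vertex of [B] gets a pair: its colour in [B] and a residue that avoids
   those of its at most [P] neighbours in [W]. *)
Lemma chiU_few_nbrs B W P : {in B, forall x, #|nbrs W x| <= P} ->
  chi (B :|: W) <= maxn (chi B * P.+1) (chi W).
Proof.
move=> few.
have [k [kB kP]] := chi_colouring B; have [f [fW fP]] := chi_colouring W.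
have /fin_all_exists[d dP] x : exists d, x \in B -> d < P.+1 /\
    {in W, forall y, adj x y -> d <> f y %% P.+1}.
  have [xB|_] := boolP (x \in B); last by exists 0.
  have [|d dP d_new] :=
    @exists_ltn_notin [seq f y %% P.+1 | y <- enum (nbrs W x)] P.+1.
    by rewrite size_map -cardE ltnS few.
  exists d => _; split=> // y yW xy dE; move/mapP: d_new; apply.
  by exists y; rewrite // mem_enum inE yW.
pose g x := k x * P.+1 + d x.
have g_mod x : x \in B -> g x %% P.+1 = d x.
  by move=> /dP[dx _]; rewrite modnMDl modn_small.
have g_div x : x \in B -> g x %/ P.+1 = k x.
  by move=> /dP[dx _]; rewrite divnMDl // divn_small // addn0.
have g_neq_f x y : x \in B -> y \in W -> adj x y -> g x <> f y.
  move=> xB yW xy gf; have [_ /(_ y yW xy)] := dP x xB.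
  by rewrite -(g_mod x xB) gf.
apply/chiP; exists (fun x => if x \in B then g x else f x).
split=> [x|x y]; rewrite !inE.
  rewrite leq_max; case: ifP => [xB _|_ /= /fW ->]; last by rewrite orbT.
  have [dx _] := dP x xB; apply/orP; left.
  apply: (@leq_trans ((k x).+1 * P.+1)).
    by rewrite /g mulSn addnC ltn_add2r.
  by rewrite leq_mul2r kB.
case: ifP => xB; case: ifP => yB //= xA yA xy.
- by move=> gg; apply: (kP x y) => //; rewrite -g_div // gg g_div.
- exact: g_neq_f.
- by move/esym; apply: g_neq_f; rewrite // adj_sym.
- exact: fP.
Qed.

Lemma chi_peel A q Q P :
  (forall R, R \subset A -> q <= omega R ->
     exists B, [/\ B \subset R, B != set0, chi B <= Q &
       {in B, forall x, #|nbrs (R :\: B) x| <= P}]) ->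
  exists U, [/\ U \subset A, omega U < q & chi (A :\: U) <= Q * P.+1].
Proof.
elim/proper_set_ind: A => A IHA shell; have [small|big] := ltnP (omega A) q.
  by exists A; rewrite setDv chi0.
have [B [BA /set0Pn[b bB] chiB fewB]] := shell A (subxx A) big.
have [||U [UA Uq chiAU]] := IHA (A :\: B).
- exact: properDI (subsetP BA b bB) bB.
- by move=> R RA; apply: shell; apply: subset_trans RA (subsetDl _ _).
exists U; split=> //; first exact: subset_trans UA (subsetDl _ _).
have sub : A :\: U \subset B :|: (A :\: B) :\: U.
  by apply/subsetP => x; rewrite !inE; case: (x \in B).
have few x : x \in B -> #|nbrs ((A :\: B) :\: U) x| <= P.
  move=> xB; apply: leq_trans (fewB x xB); apply/subset_leq_card/subsetP => y.
  by rewrite !inE => /andP[/andP[_ ->]].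
apply: leq_trans (chiS sub) (leq_trans (chiU_few_nbrs few) _).
by rewrite geq_max chiAU leq_mul2r chiB orbT.
Qed.
End Peeling.

Section PineappleFree.
Variable G : sgraph.
Implicit Types (x y z u v : G) (A B I K R S T U Y : {set G}).

(* The clique of the pineapple is [v |: T]. *)
Definition pineapple_free (s k : nat) : Prop := forall v T I,
  clique T -> #|T| = s -> complete_to T v -> stable I -> #|I| = k ->
  complete_to I v -> [disjoint T & I] -> ~ anticomplete T I.

Lemma pineapple_freeW s s' k :
  s <= s' -> pineapple_free s k -> pineapple_free s' k.
Proof.
move=> ss' free v T I cT Ts' vT sI Ik vI TI anti.
rewrite -Ts' in ss'; have [S ST Ss] := exists_subset_card ss'.
apply: (free v S I) => //; first exact: cliqueS cT.
- by move=> u /(subsetP ST)/vT.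
- exact: disjointWl ST TI.
- by move=> u x /(subsetP ST); apply: anti.
Qed.

Lemma induced_free_pineapple s k :
  induced_free (pineapple s.+1 k) G -> pineapple_free s k.
Proof.
move=> free v T I cT Ts vT /stableP sI Ik vI disj TI.
have [g [g0 gT g_adj]] := pointed_clique_embedding cT Ts vT.
have [h h_inj hI] := exists_ord_injection Ik.
have g_h i j : adj (g i) (h j) = (val i == 0).
  have [->|i0] := eqVneq i ord0; first by rewrite g0 vI.
  by rewrite (negPf (TI _ _ (gT i i0) (hI j))); apply/esym/negbTE.
have g_neq_h i j : g i <> h j.
  have [->|i0] := eqVneq i ord0 => gh.
    by have := vI _ (hI j); rewrite -gh g0 adj_irr.
  by have := disjointFr disj (gT i i0); rewrite gh hI.
pose f (p : pineapple s.+1 k) : G :=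
  match p with inl i => g i | inr j => h j end.
apply: (induced_free_no_embedding free (f := f));
  move=> [i|i] [j|j] /=.
- exact: g_adj.
- exact: g_h.
- by rewrite adj_sym.
- exact/negbTE/sI.
- by move/(clique_embedding_inj g_adj) ->.
- by move/g_neq_h.
- by move/esym/g_neq_h.
- by move/h_inj ->.
Qed.

Definition pineapple_leaves (k w : nat) : nat := k * w.+1 ^ k * k.

Definition pineapple_degree (s k w : nat) : nat :=
  ((2 * s).-1 * 2 ^ (2 * s).-1 + 1) * pineapple_leaves k w.

Definition pineapple_shell_chi (s k c w : nat) : nat :=
  (2 * s).-1 + (2 * s).-1 * (k.+1 * c.+1 * w.+1 ^ (s * k.+1)).

Variables (s k c : nat).
Hypotheses (s_gt0 : 0 < s) (free : pineapple_free s k).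
Hypothesis chi_c : omega_lt_chi_leq G (2 * s).-1 c.

Lemma card_pineapple_leaves v T R Y : clique T -> #|T| = s -> complete_to T v ->
  Y \subset R -> complete_to Y v -> [disjoint T & Y] -> anticomplete T Y ->
  #|Y| <= pineapple_leaves k (omega R).
Proof.
move=> cT Ts vT YR vY disj TY.
apply: (@leq_trans (pineapple_leaves k (omega Y))); last first.
  by rewrite !leq_mul // leq_expn2r // ltnS omegaS.
apply: card_leq_no_stable => I IY sI Ik; apply: (@free v T I) => //.
- by move=> u /(subsetP IY)/vY.
- exact: disjointWr IY disj.
- by move=> u x uT /(subsetP IY); apply: TY.
Qed.

Definition pineapple_shell K R : {set G} :=
  K :|: [set x in R | #|non_nbrs K x| < s].

(* Such a vertex [y] is a leaf at one of its neighbours in [K] of a pineapple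
   with clique in [K]. *)
Lemma card_touching_many_non_nbrs K R : clique K ->
  #|[set y in R :\: K | touches K y && (s <= #|non_nbrs K y|)]|
    <= #|K| * 2 ^ #|K| * pineapple_leaves k (omega R).
Proof.
move=> /cliqueP cK.
pose Y (p : G * {set G}) :=
  [set y in R :\: K | [&& adj p.1 y, p.2 \subset non_nbrs K y & #|p.2| == s]].
have sub : [set y in R :\: K | touches K y && (s <= #|non_nbrs K y|)]
    \subset \bigcup_(p in setX K (powerset K)) Y p.
  apply/subsetP => y; rewrite inE => /and3P[yRK /exists_inP[u uK yu]].
  move=> /exists_subset_card[S Sy Ss]; apply/bigcupP; exists (u, S).
    by rewrite !inE uK (subset_trans Sy (non_nbrs_sub K y)).
  by rewrite inE yRK /= adj_sym yu Sy Ss /=.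
apply: leq_trans (subset_leq_card sub) (leq_trans (card_bigcup_leq _ _) _).
rewrite -card_powerset -cardsX; apply: leq_sum_const => -[u S].
rewrite !inE /= => /andP[uK SK].
have [->|[y0]] := set_0Vmem (Y (u, S)); first by rewrite cards0.
rewrite inE /= => /and4P[_ uy0 /subsetP Sy0 /eqP Ss].
apply: (@card_pineapple_leaves u S).
- exact/(cliqueS SK)/cliqueP.
- by [].
- move=> x xS; apply: cK => //; first exact: (subsetP SK).
  apply: contraTneq uy0 => ->; have := Sy0 x xS.
  by rewrite inE adj_sym => /andP[].
- by apply/subsetP => y; rewrite !inE => /andP[/andP[]].
- by move=> y; rewrite inE => /and3P[].
- apply/pred0P => y; apply/negP => /= /andP[/(subsetP SK) yK].
  by rewrite !inE yK.
- move=> x y xS; rewrite inE => /and4P[_ _ /subsetP/(_ x xS)].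
  by rewrite inE adj_sym => /andP[].
Qed.

Section Shell.
Variables K R : {set G}.
Hypotheses (cK : clique K) (Ks : #|K| = (2 * s).-1).

Lemma card_untouched_nbrs x : #|non_nbrs K x| < s ->
  #|[set y in R :\: K | adj x y && ~~ touches K y]|
    <= pineapple_leaves k (omega R).
Proof.
move=> xs; have [|T [TK cT Ts xT]] := exists_complete_subclique cK _ xs.
  by rewrite Ks.
apply: (@card_pineapple_leaves x T) => //.
- by apply/subsetP => y; rewrite !inE => /andP[/andP[]].
- by move=> y; rewrite inE => /and3P[].
- apply/pred0P => y; apply/negP => /= /andP[/(subsetP TK) yK].
  by rewrite !inE yK.
- move=> u y /(subsetP TK) uK; rewrite inE => /and3P[_ _ /touchesPn/(_ u uK)].
  by rewrite adj_sym.
Qed.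

Lemma card_pineapple_shell_nbrs x : x \in pineapple_shell K R ->
  #|nbrs (R :\: pineapple_shell K R) x| <= pineapple_degree s k (omega R).
Proof.
move=> xB; set few := [set y in R :\: K | adj x y && ~~ touches K y].
have sub : nbrs (R :\: pineapple_shell K R) x \subset
    [set y in R :\: K | touches K y && (s <= #|non_nbrs K y|)] :|: few.
  apply/subsetP => y; rewrite !inE negb_or => /andP[/andP[/andP[yK ys] yR] xy].
  by move: ys; rewrite yK yR xy /= -leqNgt => ->; rewrite andbT orbN.
apply: leq_trans (subset_leq_card sub) _.
rewrite cardsU (leq_trans (leq_subr _ _)) // /pineapple_degree mulnDl mul1n.
rewrite leq_add // -?Ks ?card_touching_many_non_nbrs //.
case/setUP: xB => [xK|]; last first.
  by rewrite inE => /andP[_]; apply: card_untouched_nbrs.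
rewrite (_ : few = set0) ?cards0 //; apply/setP => y; rewrite !inE.
apply/negP => /and3P[_ xy /touchesPn/(_ x xK)].
by rewrite adj_sym xy.
Qed.

Lemma chi_pineapple_nbrs v :
  chi (nbrs R v) <= k.+1 * c.+1 * (omega R).+1 ^ (s * k.+1).
Proof.
have chi_s : omega_lt_chi_leq G s c by apply: omega_lt_chi_leqW chi_c; lia.
have nbrs_free : ~ has_mK s k.+1 (nbrs R v).
  move=> [S [SN cS Ss /has_mK_stable[//|I [IA sI Ik]]]].
  have IP x : x \in I -> [/\ adj v x, x \notin S & anticomplete_to S x].
    by move=> /(subsetP IA)/setIP[+ /anti_nbhdP[? ?]]; rewrite inE => /andP[].
  apply: (@free v S I) => //.
  - by move=> u /(subsetP SN); rewrite inE => /andP[].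
  - by move=> x /IP[].
  - by apply/pred0P => x; apply/negP => /= /andP[xS /IP[_ /negP]].
  - by move=> u x uS /IP[_ _ /(_ u uS)]; rewrite adj_sym.
apply: leq_trans (chi_mK_free s_gt0 chi_s nbrs_free) _.
by rewrite leq_mul // leq_expn2r // ltnS omegaS // nbrs_sub.
Qed.

Lemma chi_pineapple_shell :
  chi (pineapple_shell K R) <= pineapple_shell_chi s k c (omega R).
Proof.
have sub : pineapple_shell K R \subset closed_nbhd R K.
  apply: setUS; apply/subsetP => x; rewrite !inE => /andP[-> xs] /=.
  rewrite touches_non_nbrs; apply: contraTneq xs => ->.
  by rewrite Ks; lia.
apply: leq_trans (chiS sub) _; rewrite /pineapple_shell_chi -Ks.
by apply: chi_closed_nbhd => v _; apply: chi_pineapple_nbrs.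
Qed.
End Shell.

Lemma pineapple_peel A : exists U, [/\ U \subset A, omega U < (2 * s).-1
  & chi (A :\: U) <= pineapple_shell_chi s k c (omega A)
                     * (pineapple_degree s k (omega A)).+1].
Proof.
apply: chi_peel => R RA /exists_clique_card[K [KR cK Ks]].
have wR : (omega R).+1 <= (omega A).+1 by rewrite ltnS omegaS.
exists (pineapple_shell K R); split.
- by rewrite subUset KR; apply: setId_sub.
- by rewrite setU_eq0 negb_and -card_gt0 Ks; apply/orP; left; lia.
- apply: leq_trans (chi_pineapple_shell R cK Ks) _.
  by rewrite leq_add2l !leq_mul // leq_expn2r.
- move=> x xB; apply: leq_trans (card_pineapple_shell_nbrs cK Ks xB) _.
  by rewrite !leq_mul // leq_expn2r.
Qed.

Lemma chi_pineapple_free A :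
  chi A <= (((2 * s).-1 + (2 * s).-1 * (k.+1 * c.+1)) *
     (((2 * s).-1 * 2 ^ (2 * s).-1 + 1) * k * k).+1 + c) *
     (omega A).+1 ^ (s * k.+1 + k).
Proof.
have [U [UA Us chiAU]] := pineapple_peel A.
apply: leq_trans (chi_setID A U) _; rewrite addnC (setIidPr UA).
apply: leq_trans (leq_add chiAU (chi_c Us)) _.
rewrite /pineapple_shell_chi /pineapple_degree /pineapple_leaves expnD.
have: 0 < (omega A).+1 ^ (s * k.+1) by rewrite expn_gt0.
have: 0 < (omega A).+1 ^ k by rewrite expn_gt0.
move: (_ ^ (s * k.+1)) (_ ^ k) ((2 * s).-1 * 2 ^ _ + 1) => a b d b0 a0.
move: (2 * s).-1 (k.+1 * c.+1) => m e.
rewrite [leqRHS]mulnDl leq_add ?leq_pmulr ?muln_gt0 ?a0 //.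
rewrite mulnACA leq_mul //; nia.
Qed.
End PineappleFree.

Lemma strongly_pollyanna_pineapple t k : 0 < t ->
  strongly_pollyanna (2 * t%:Z - 4)%R (induced_free (pineapple t k)).
Proof.
case: t => // t _ F; pose s := maxn 1 t.
move=> /(@good_omega_lt_chi_leq _ (2 * s).-1)[|c chi_c].
  by rewrite /s; lia.
apply: poly_chi_bounded_monomial => G [/induced_free_pineapple free FG].
apply: (@chi_pineapple_free G s k c _ _ (chi_c G FG)); first exact: leq_maxl.
exact: pineapple_freeW (leq_maxr _ _) free.
Qed.

(** * Lollipops *)

Section Lollipop.
Variable G : sgraph.
Implicit Types (x y z u v w a b c : G) (A B C D E K S T : {set G}).

Lemma chi_superadditive g : (forall m n, g m + g n <= g (m + n)) ->
  (forall A, chi A <= g (omega A) \/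
     exists B, [/\ B \proper A, B != set0 &
       anticomplete B (A :\: B) \/ omega B + omega (A :\: B) <= omega A]) ->
  forall A, chi A <= g (omega A).
Proof.
move=> gD split; have g_mono m n : m <= n -> g m <= g n.
  by move=> mn; rewrite -(subnKC mn) (leq_trans _ (gD _ _)) ?leq_addr.
elim/proper_set_ind => A IHA; have [//|[B [BA /set0Pn[b bB] AB]]] := split A.
have sBA := proper_sub BA; have chiB := IHA B BA.
have chiAB := IHA _ (properDI (subsetP sBA b bB) bB).
rewrite -(setUDK sBA); case: AB => [anti|omegaA].
  apply: leq_trans (chiU_anticomplete anti) _; rewrite setUDK // geq_max.
  by rewrite (leq_trans chiB) ?(leq_trans chiAB) ?g_mono ?omegaS ?subsetDl.
apply: leq_trans (chiU _ _) (leq_trans (leq_add chiB chiAB) _).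
by rewrite setUDK // (leq_trans (gD _ _)) // g_mono.
Qed.

Lemma anti_nbhd_sym K C : (C \subset anti_nbhd K) = (K \subset anti_nbhd C).
Proof.
wlog suff: K C / C \subset anti_nbhd K -> K \subset anti_nbhd C.
  by move=> sym; apply/idP/idP; apply: sym.
move=> /subsetP CK; apply/subsetP => u uK; apply/anti_nbhdP; split.
  by apply/negP => /CK/anti_nbhdP[/negP].
by move=> v /CK/anti_nbhdP[_ /(_ u uK)]; rewrite adj_sym.
Qed.

Lemma touches_of_not_anti K E :
  clique E -> 1 < #|E| -> ~~ (E \subset anti_nbhd K) ->
  exists2 x, x \in E & touches K x.
Proof.
move=> /cliqueP cE E2 /subsetPn[x xE].
rewrite inE negb_and !negbK => /orP[xK|]; last by exists x.
have /set0Pn[y /setD1P[yx yE]] : E :\ x != set0.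
  by move: E2; rewrite -card_gt0 (cardsD1 x) xE.
by exists y => //; apply/exists_inP; exists x => //; apply: cE.
Qed.

Definition lollipop_free (s : nat) : Prop := forall T a b c,
  clique T -> #|T| = s -> complete_to T a -> adj a b -> adj b c -> a != c ->
  ~~ adj a c -> anticomplete_to T b -> ~ anticomplete_to T c.

Lemma lollipop_freeW s s' : s <= s' -> lollipop_free s -> lollipop_free s'.
Proof.
move=> ss' free T a b c cT Ts' aT ab bc ac nac bT cT'.
rewrite -Ts' in ss'; have [S ST Ss] := exists_subset_card ss'.
apply: (free S a b c) => //; first exact: cliqueS cT.
- by move=> u /(subsetP ST)/aT.
- by move=> u /(subsetP ST)/bT.
- by move=> u /(subsetP ST)/cT'.
Qed.

Lemma induced_free_lollipop s :
  induced_free (lollipop s.+1) G -> lollipop_free s.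
Proof.
move=> free T a b c cT Ts aT ab bc ac nac bT cT'.
have [g [g0 gT g_adj]] := pointed_clique_embedding cT Ts aT.
pose h (j : 'I_2) := if j == ord0 then b else c.
have h_adj i j : adj (h i) (h j) = (i != j).
  case: i j => [[|[|//]] ?] [[|[|//]] ?]; rewrite /h -!val_eqE /= ?adj_irr //.
  by rewrite adj_sym.
have g_h i j : adj (g i) (h j) = (val i == 0) && (val j == 0).
  rewrite /h -val_eqE /=; have [->|i0] := eqVneq i ord0; rewrite ?g0.
    by case: ifP; rewrite // (negPf nac).
  rewrite -val_eqE /= in i0; rewrite (negPf i0) adj_sym /=.
  by case: ifP => _; apply/negbTE; [apply: bT|apply: cT']; apply: gT.
have g_neq_h i j : g i <> h j.
  have [->|i0] := eqVneq i ord0; rewrite /h ?g0; case: ifP => _ gh.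
  - by rewrite gh adj_irr in ab.
  - by rewrite gh eqxx in ac.
  - by have := cT' _ (gT i i0); rewrite gh adj_sym bc.
  - by have := aT _ (gT i i0); rewrite gh (negPf nac).
pose f (p : lollipop s.+1) : G := match p with inl i => g i | inr j => h j end.
apply: (induced_free_no_embedding free (f := f));
  move=> [i|i] [j|j] /=.
- exact: g_adj.
- exact: g_h.
- by rewrite adj_sym.
- exact: h_adj.
- by move/(clique_embedding_inj g_adj) ->.
- by move/g_neq_h.
- by move/esym/g_neq_h.
- by move/(clique_embedding_inj h_adj) ->.
Qed.

Section Structure.
Variable s : nat.
Hypotheses (s_gt0 : 0 < s) (free : lollipop_free s).

Lemma no_lollipop T a b c : clique T -> #|T| = s -> complete_to T a ->
  adj a b -> adj b c -> ~~ adj a c -> anticomplete_to T b ->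
  ~ anticomplete_to T c.
Proof.
move=> cT Ts aT ab bc nac bT cT'; apply: (free cT Ts aT ab bc _ nac bT cT').
have /card_gt0P[u uT] : 0 < #|T| by rewrite Ts.
by apply: contraNneq (cT' u uT) => <-; apply: aT.
Qed.

Lemma lollipop_complete_subclique K b c : clique K -> (2 * s).-1 <= #|K| ->
  touches K b -> ~~ touches K c -> adj b c ->
  exists T, [/\ T \subset K, clique T, #|T| = s & complete_to T b].
Proof.
move=> cK Ks /exists_inP[a aK ba] /touchesPn cK' bc.
apply: exists_complete_subclique => //; rewrite ltnNge.
apply/negP => /exists_subset_card[T TN Ts].
have TK := subset_trans TN (non_nbrs_sub K b).
have bT : anticomplete_to T b by move=> u /(subsetP TN); rewrite inE => /andP[].
apply: (@no_lollipop T a b c) => //.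
- exact: cliqueS cK.
- move=> u uT; move/cliqueP: cK; apply=> //; first exact: (subsetP TK).
  by apply: contraTneq ba => ->; apply: bT.
- by rewrite adj_sym.
- by rewrite adj_sym cK'.
- by move=> u /(subsetP TK)/cK'.
Qed.

Lemma touches_both_complete K C x :
  clique K -> clique C -> (2 * s).-1 <= #|C| -> anticomplete K C ->
  touches K x -> touches C x -> complete_to K x.
Proof.
move=> /cliqueP cK cC Cs KC /exists_inP[k kK xk] Cx u uK.
apply/negPn/negP => xu.
have Ck : ~~ touches C k by apply/touchesPn => v; apply: KC.
have [T [TC cT Ts xT]] := lollipop_complete_subclique cC Cs Cx Ck xk.
apply: (@no_lollipop T x k u) => //.
- by apply: cK => //; apply: contraTneq xk => ->.
- by move=> v /(subsetP TC); apply: KC.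
- by move=> v /(subsetP TC); apply: KC.
Qed.

Definition touching_both A K C : {set G} :=
  [set x in A | touches K x && touches C x].

Definition within_distance2 A K : {set G} :=
  [set x in A |
    [|| x \in K, touches K x | [exists w in A, touches K w && adj x w]]].

Lemma within_distance2_anticomplete A K : clique K -> (2 * s).-1 <= #|K| ->
  anticomplete (within_distance2 A K) (A :\: within_distance2 A K).
Proof.
move=> cK Ks x y.
rewrite inE => /andP[xA near] /setDP[yA far]; apply/negP => xy.
move: far; rewrite inE yA /= !negb_or negb_exists_in.
move=> /and3P[_ Ky /forall_inP far].
have [Kx|Kx] := boolP (touches K x).
  by move: (far x xA); rewrite Kx adj_sym xy.
have xK : x \notin K.
  by apply/negP => xK; move/touchesPn: Ky => /(_ x xK); rewrite adj_sym xy.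
move: near; rewrite (negPf xK) (negPf Kx) /= => /exists_inP[w wA /andP[Kw xw]].
rewrite adj_sym in xw.
have [T [TK cT Ts wT]] := lollipop_complete_subclique cK Ks Kw Kx xw.
apply: (@no_lollipop T w x y) => //.
- by have := far w wA; rewrite Kw adj_sym.
- by move=> u /(subsetP TK); move/touchesPn: Kx; apply.
- by move=> u /(subsetP TK); move/touchesPn: Ky; apply.
Qed.

Definition far_pair A (p : {set G} * {set G}) : bool :=
  [&& p.1 \subset A, p.2 \subset A, clique p.1, clique p.2,
      (2 * s).-1 <= #|p.1|, (2 * s).-1 <= #|p.2| & p.2 \subset anti_nbhd p.1].

Lemma far_pair_of_has_mK A : has_mK (2 * s).-1 2 A -> exists p, far_pair A p.
Proof.
move=> [K [KA cK Ks [C [CA cC Cs _]]]]; exists (K, C).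
by move: CA; rewrite subsetI /far_pair /= KA cK cC Ks Cs leqnn => /andP[-> ->].
Qed.

Section FarPair.
Variables A K C : {set G}.
Hypothesis KC_far : far_pair A (K, C).
Hypothesis K_max : forall p, far_pair A p -> #|p.1| <= #|K|.

Lemma omega_touching_both :
  omega (touching_both A K C) + omega (A :\: touching_both A K C) <= omega A.
Proof.
have /and5P[/= KA CA cK cC /and3P[Ks Cs CK]] := KC_far.
have KC : anticomplete K C.
  move=> u v uK vC; rewrite adj_sym.
  by have /anti_nbhdP[_ /(_ u uK)] := subsetP CK v vC.
set X := touching_both A K C.
have XK : complete X K.
  move=> x u; rewrite inE => /and3P[_ Kx Cx].
  exact: touches_both_complete Cx u.
have XA : X :|: K \subset A.
  by rewrite subUset KA andbT; apply: setId_sub.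
apply: leq_trans (leq_trans (omegaU_complete XK) (omegaS XA)).
rewrite leq_add2l (omega_clique cK); apply/omega_leP => E EX cE.
have EA := subset_trans EX (subsetDl _ _); rewrite leqNgt; apply/negP => KE.
have E_not_far D : D \in [:: K; C] -> ~~ (E \subset anti_nbhd D).
  move=> D_KC; apply/negP => ED.
  suff /K_max/= : far_pair A (E, D) by rewrite leqNgt KE.
  rewrite /far_pair /= EA cE (leq_trans Ks (ltnW KE)) anti_nbhd_sym ED.
  by move: D_KC; rewrite !inE => /orP[] /eqP->; rewrite ?KA ?CA ?cK ?cC ?Ks ?Cs.
have E2 : 1 < #|E| by apply: leq_ltn_trans KE; move: s_gt0 Ks; clear; lia.
have [x xE Kx] : exists2 x, x \in E & touches K x.
  by apply: touches_of_not_anti => //; apply: E_not_far; rewrite mem_head.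
have [y yE Cy] : exists2 y, y \in E & touches C y.
  by apply: touches_of_not_anti => //; apply: E_not_far; rewrite !inE eqxx orbT.
have Cx : ~~ touches C x.
  by have /setDP[xA] := subsetP EX x xE; rewrite inE xA Kx.
have Ky : ~~ touches K y.
  by have /setDP[yA] := subsetP EX y yE; rewrite inE yA Cy andbT.
have xy : adj x y by move/cliqueP: cE; apply=> //; apply: contraTneq Kx => ->.
have [T [TK cT Ts xT]] := lollipop_complete_subclique cK Ks Kx Ky xy.
have /exists_inP[v vC yv] := Cy.
apply: (@no_lollipop T x y v) => //.
- by move/touchesPn: Cx; apply.
- by move=> u /(subsetP TK); move/touchesPn: Ky; apply.
- by move=> u /(subsetP TK) uK; rewrite adj_sym KC.
Qed.

(* Split off the vertices touching both cliques or, if there are none, the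
   component of [K]. *)
Lemma far_pair_split : exists B, [/\ B \proper A, B != set0 &
  anticomplete B (A :\: B) \/ omega B + omega (A :\: B) <= omega A].
Proof.
have /and5P[/= KA CA cK cC /and3P[Ks Cs /subsetP CK]] := KC_far.
have /card_gt0P[k kK] : 0 < #|K|.
  by apply: leq_trans Ks; move: s_gt0; clear; lia.
have /card_gt0P[c cC'] : 0 < #|C|.
  by apply: leq_trans Cs; move: s_gt0; clear; lia.
have [X0|X_neq0] := eqVneq (touching_both A K C) set0; last first.
  exists (touching_both A K C); split=> //; last first.
    by right; apply: omega_touching_both.
  apply/properP; split; first exact: setId_sub.
  exists k; first exact: (subsetP KA).
  rewrite inE negb_and; apply/orP; right; rewrite negb_and; apply/orP; right.
  by apply/touchesPn => v /CK/anti_nbhdP[_ /(_ k kK)]; rewrite adj_sym.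
exists (within_distance2 A K); split; last first.
- by left; apply: within_distance2_anticomplete.
- by apply/set0Pn; exists k; rewrite inE (subsetP KA) // kK.
- apply/properP; split; first exact: setId_sub.
  have /anti_nbhdP[cnK /touchesPn Kc] := CK c cC'.
  exists c; first exact: (subsetP CA).
  rewrite inE (subsetP CA) //= (negPf cnK) (negPf Kc) /=.
  apply/exists_inP => -[w wA /andP[Kw cw]].
  have: w \in touching_both A K C.
    by rewrite inE wA Kw; apply/exists_inP; exists c; rewrite // adj_sym.
  by rewrite X0 inE.
Qed.
End FarPair.

Lemma chi_lollipop_free g : (forall m n, g m + g n <= g (m + n)) ->
  (forall A, ~ has_mK (2 * s).-1 2 A -> chi A <= g (omega A)) ->
  forall A, chi A <= g (omega A).
Proof.
move=> gD chi_mK; apply: chi_superadditive => // A.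
have [/existsP[p0 p0_far]|/existsPn no_far] := boolP [exists p, far_pair A p].
  right; have [[K C] KC_far K_max] :=
    @arg_maxnP _ p0 (far_pair A) (fun p => #|p.1|) p0_far.
  exact: far_pair_split KC_far K_max.
left; apply: chi_mK => /far_pair_of_has_mK[p p_far].
by have := no_far p; rewrite p_far.
Qed.
End Structure.
End Lollipop.

Lemma strongly_pollyanna_lollipop t : 0 < t ->
  strongly_pollyanna (3 * t%:Z - 6)%R (induced_free (lollipop t)).
Proof.
case: t => // t _ F; pose s := maxn 1 t; pose e := (2 * s).-1 * 2.
have s0 : 0 < s := leq_maxl _ _.
move=> /(@good_omega_lt_chi_leq _ (2 * s).-1)[|c chi_c].
  by rewrite /s; lia.
apply: (@poly_chi_bounded_monomial _ (2 * c.+1 * 2 ^ e) e) => G [free FG] A.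
have s_free : lollipop_free G s :=
  lollipop_freeW (leq_maxr _ _) (induced_free_lollipop free).
pose g w := 2 * c.+1 * 2 ^ e * w ^ e.
have gD m n : g m + g n <= g (m + n).
  by rewrite -mulnDr leq_mul // leq_expD // /e; lia.
apply: leq_trans (chi_lollipop_free s0 s_free gD _ A) _; last first.
  by rewrite leq_mul // leq_expn2r.
move=> B B_free.
have [/omega_eq0->|w0] := posnP (omega B); first by rewrite chi0.
have q0 : 0 < (2 * s).-1 by lia.
apply: leq_trans (chi_mK_free q0 (chi_c G FG) B_free) _.
by rewrite /g -[leqRHS]mulnA leq_mul // -expnMn leq_expn2r //; lia.
Qed.

(** * Bowties *)

Section TriangleFreeClasses.
Variable G : sgraph.
Implicit Types (x y z : G) (A B R U : {set G}).

Definition triangle_free_classes (C : eqType) A (g : G -> C) : Prop :=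
  {in A & &, forall x y z, adj x y -> adj x z -> adj y z -> g x = g y ->
    g x <> g z}.

Lemma omega_triangle_free A :
  {in A & &, forall x y z, adj x y -> adj x z -> ~~ adj y z} -> omega A <= 2.
Proof.
move=> no_triangle; apply/omega_leP => K /subsetP KA /cliqueP cK.
rewrite leqNgt; apply/negP => /card_gt2P[x [y [z [[xK yK zK] [xy yz zx]]]]].
have := no_triangle x y z (KA x xK) (KA y yK) (KA z zK).
by rewrite !cK // 1?eq_sym // => /(_ isT isT).
Qed.

Lemma chi_triangle_free_classes (C : eqType) (g : G -> C) (s : seq C) A c :
  {in A, forall x, g x \in s} -> triangle_free_classes A g ->
  omega_lt_chi_leq G 3 c -> chi A <= size s * c.
Proof.
move=> gs g_tri chi_c; apply: chi_classes gs _ => i; apply: chi_c; rewrite ltnS.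
apply: omega_triangle_free => x y z; rewrite !inE.
move=> /andP[xA /eqP gx] /andP[yA /eqP gy] /andP[zA /eqP gz] xy xz.
by apply/negP => yz; apply: (g_tri x y z); rewrite ?gx.
Qed.

Lemma triangle_free_classes_extend (C : eqType) A B (f g : G -> C) :
  {in B &, forall x y, adj x y -> f x <> f y} ->
  triangle_free_classes (A :\: B) g ->
  {in B & A :\: B & A :\: B, forall x y z, adj x y -> adj x z -> adj y z ->
     f x = g y -> f x <> g z} ->
  triangle_free_classes A (fun x => if x \in B then f x else g x).
Proof.
move=> f_col g_tri cross x y z xA yA zA xy xz yz.
have inD u : u \in A -> u \notin B -> u \in A :\: B.
  by move=> uA uB; apply/setDP.
have [yx zx zy] : [/\ adj y x, adj z x & adj z y] by split; rewrite adj_sym.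
case: ifP => [xB|/negbT/(inD x xA) xB]; case: ifP => [yB|/negbT/(inD y yA) yB].
- by move/f_col; case.
- case: ifP => [zB|/negbT/(inD z zA) zB]; last exact: cross.
  by move=> _; apply: f_col.
- case: ifP => [zB|/negbT/(inD z zA) zB] gxy; rewrite gxy.
    exact: f_col.
  exact: (cross y x z).
- case: ifP => [zB|/negbT/(inD z zA) zB]; last exact: g_tri.
  by move=> gxy gxz; apply: (cross z x y); rewrite -?gxy.
Qed.

Lemma chi_stable_nbrs_peel A q Q c : omega_lt_chi_leq G 3 c ->
  (forall R, R \subset A -> q <= omega R ->
     exists B, [/\ B \subset R, B != set0, chi B <= Q &
       {in B, forall x, stable (nbrs (R :\: B) x)}]) ->
  exists U, [/\ U \subset A, omega U < q & chi (A :\: U) <= Q * c].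
Proof.
move=> chi_c shell; suff [U [g [UA Uq gQ g_tri]]] : exists U (g : G -> nat),
    [/\ U \subset A, omega U < q, {in A :\: U, forall x, g x < Q}
      & triangle_free_classes (A :\: U) g].
  exists U; split=> //; rewrite -(size_iota 0 Q).
  by apply: chi_triangle_free_classes g_tri chi_c => x /gQ; rewrite mem_iota.
elim/proper_set_ind: A shell => A IHA shell.
have [small|big] := ltnP (omega A) q.
  by exists A, (fun=> 0); rewrite setDv; split=> // x; rewrite inE.
have [B [BA /set0Pn[b bB] chiB stB]] := shell A (subxx A) big.
have [||U [g [UA Uq gQ g_tri]]] := IHA (A :\: B).
- exact: properDI (subsetP BA b bB) bB.
- by move=> R RA; apply: shell; apply: subset_trans RA (subsetDl _ _).
have [f [fB fP]] := chi_colouring B; rewrite setDDl setUC -setDDl in gQ g_tri.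
exists U, (fun x => if x \in B then f x else g x); split=> //.
- exact: subset_trans UA (subsetDl _ _).
- move=> x xAU; case: ifP => [xB|/negbT xB].
    exact: leq_trans (fB x xB) chiB.
  by apply: gQ; apply/setDP.
apply: triangle_free_classes_extend => // x y z xB /setDP[/setDP[yA _] yB].
move=> /setDP[/setDP[zA _] zB] xy xz yz; exfalso.
move/stableP: (stB x xB) => /(_ y z).
by rewrite !inE yA yB zA zB xy xz yz => /(_ isT isT).
Qed.
End TriangleFreeClasses.

Section Bowtie.
Variable G : sgraph.
Implicit Types (x y z u v a b : G) (A B K L R S U : {set G}).

Definition bowtie_free : Prop := forall v a b x y,
  adj v a -> adj v b -> adj v x -> adj v y -> adj a b -> adj x y ->
  ~ [/\ ~~ adj a x, ~~ adj a y, ~~ adj b x & ~~ adj b y].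

Lemma bowtie_no_false_twins (p q : bowtie) : adj p =1 adj q -> p = q.
Proof.
case: p q => [[i j]|] [[i' j']|] twins //; try by have := twins None.
have := twins (Some (i', rev_ord j')); rewrite /= /mK_adj eqxx /=.
have -> : j' != rev_ord j' by case: j' {twins} => [[|[|//]] ?].
move=> /andP[/eqP -> ne]; congr (Some (_, _)); apply: val_inj; move: ne.
by case: j {twins} => [[|[|//]] ?]; case: j' => [[|[|//]] ?].
Qed.

Lemma induced_free_bowtie : induced_free bowtie G -> bowtie_free.
Proof.
move=> free v a b x y va vb vx vy ab xy [nax nay nbx nby].
pose h (p : mK 2 2) : G := if p.1 == ord0 then (if p.2 == ord0 then a else b)
                           else (if p.2 == ord0 then x else y).
have h_adj p q : adj (h p) (h q) = mK_adj p q.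
  have E := (adj_irr, ab, xy, negPf nax, negPf nay, negPf nbx, negPf nby).
  case: p q => [[[|[|//]] ?] [[|[|//]] ?]] [[[|[|//]] ?] [[|[|//]] ?]];
  by rewrite /h /mK_adj -!val_eqE /= ?E // adj_sym ?E.
have v_h p : adj v (h p) by rewrite /h; case: ifP; case: ifP.
pose f (o : bowtie) : G := if o is Some p then h p else v.
have f_adj : {mono f : o o' / adj o o'}.
  by case=> [p|] [q|] //=; rewrite ?h_adj ?v_h ?adj_irr // adj_sym v_h.
apply: (induced_free_no_embedding free f_adj).
exact: no_false_twins_mono_inj bowtie_no_false_twins f_adj.
Qed.

Hypothesis free : bowtie_free.

Lemma chi_bowtie_nbrs R v : chi (nbrs R v) <= 4 * (omega R).+1 ^ 4.
Proof.
have chi_1 : omega_lt_chi_leq G 2 1.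
  by move=> A A1; apply: chi_stable; apply: omega_leq1_stable.
suff nbrs_free : ~ has_mK 2 2 (nbrs R v).
  apply: leq_trans (chi_mK_free (ltn0Sn 1) chi_1 nbrs_free) _.
  by rewrite leq_mul // leq_expn2r // ltnS omegaS // nbrs_sub.
move=> [S [/subsetP SN /cliqueP cS S2 [T [/subsetP TN /cliqueP cT T2 _]]]].
have /card_gt1P[a [b [aS bS ab]]] : 1 < #|S| by rewrite S2.
have /card_gt1P[x [y [xT yT xy]]] : 1 < #|T| by rewrite T2.
have Sv u : u \in S -> adj v u by move/SN; rewrite inE => /andP[].
have TP u : u \in T -> adj v u /\ anticomplete_to S u.
  by move=> /TN/setIP[+ /anti_nbhdP[_ ?]]; rewrite inE => /andP[].
have [[vx xS] [vy yS]] := (TP x xT, TP y yT).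
apply: (free (Sv a aS) (Sv b bS) vx vy (cS a b aS bS ab) (cT x y xT yT xy)).
rewrite ![adj _ x]adj_sym ![adj _ y]adj_sym.
by split; [apply: xS|apply: yS|apply: xS|apply: yS].
Qed.

Section Shell.
Variables K R : {set G}.

Definition near_clique L : bool := [&& clique L, #|L| == 4 & 3 <= #|L :&: K|].

Definition bowtie_shell : {set G} := K :|:
  [set y in R | [exists L, near_clique L && (2 <= #|nbrs L y|)]].

Lemma outside_shell_nbr_unique L z u u' :
  z \in R :\: bowtie_shell -> near_clique L ->
  u \in L -> u' \in L -> u != u' -> adj u z -> ~~ adj u' z.
Proof.
move=> /setDP[zR zB] nL uL u'L uu' uz; apply: contra zB => u'z.
rewrite !inE zR; apply/orP; right; apply/existsP; exists L; rewrite nL /=.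
by apply/card_gt1P; exists u, u'; rewrite !inE uL u'L adj_sym uz adj_sym u'z.
Qed.

Lemma near_clique_nbrs_stable L x : near_clique L -> x \in L ->
  stable (nbrs (R :\: bowtie_shell) x).
Proof.
move=> nL xL; apply/stableP => z w; rewrite !in_nbrs.
move=> /andP[zRB xz] /andP[wRB xw]; apply/negP => zw.
have /and3P[/cliqueP cL /eqP L4 _] := nL.
have /card_gt1P[a [b []]] : 1 < #|L :\ x|.
  by move: L4; rewrite (cardsD1 x) xL add1n => -[->].
rewrite !inE => /andP[ax aL] /andP[bx bL] ab.
have out u v : u \in L -> u != x -> v \in R :\: bowtie_shell -> adj x v ->
    ~~ adj u v.
  move=> uL ux vRB.
  by apply: (outside_shell_nbr_unique vRB nL); rewrite // eq_sym.
apply: (free (v := x) (a := a) (b := b) (x := z) (y := w)) => //.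
- by apply: cL; rewrite // eq_sym.
- by apply: cL; rewrite // eq_sym.
- exact: cL.
- by split; apply: out.
Qed.

Lemma two_nbrs_near_clique_stable L x : near_clique L -> #|nbrs L x| = 2 ->
  stable (nbrs (R :\: bowtie_shell) x).
Proof.
move=> nL L2; have /and3P[/cliqueP cL /eqP L4 _] := nL.
have /card_gt1P[c [d []]] : 1 < #|non_nbrs L x|.
  by have := card_nbrs L x; rewrite L2 L4 add2n => -[->].
rewrite !inE => /andP[c_L xc] /andP[d_L xd] cd.
have out u v : u \in nbrs L x -> v \in R :\: bowtie_shell -> adj x v ->
    ~~ adj u v.
  rewrite inE => /andP[uL xu] vRB xv; apply/negP => uv.
  have [uc ud] : u != c /\ u != d by split; apply: contraTneq xu => ->.
  apply: (free (v := u) (a := c) (b := d) (x := x) (y := v)) => //.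
  - exact: cL.
  - exact: cL.
  - by rewrite adj_sym.
  - exact: cL.
  - rewrite ![adj _ x]adj_sym; split=> //.
      exact: (outside_shell_nbr_unique vRB nL uL).
    exact: (outside_shell_nbr_unique vRB nL uL).
have /card_gt1P[a [b [aN bN ab]]] : 1 < #|nbrs L x| by rewrite L2.
have [[aL xa] [bL xb]] : (a \in L /\ adj x a) /\ (b \in L /\ adj x b).
  by move: aN bN; rewrite !inE => /andP[-> ->] /andP[-> ->].
apply/stableP => z w; rewrite !in_nbrs => /andP[zRB xz] /andP[wRB xw].
apply/negP => zw; apply: (free xa xb xz xw (cL a b aL bL ab) zw).
by split; apply: out.
Qed.

Hypotheses (cK : clique K) (K4 : #|K| = 4).

Lemma near_clique_self : near_clique K.
Proof. by rewrite /near_clique cK K4 setIid K4. Qed.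

Lemma card_nbrs_near_clique L x : near_clique L ->
  #|nbrs L x| <= #|nbrs K x|.+1.
Proof.
move=> /and3P[_ /eqP L4 L3].
have LK : #|L :\: K| <= 1 by rewrite cardsD L4; move: L3; clear; lia.
rewrite -(cardsID K) -addn1 leq_add //.
  by apply/subset_leq_card/subsetP => u; rewrite !inE => /andP[/andP[_ ->] ->].
apply: leq_trans LK; apply/subset_leq_card/subsetP => u.
by rewrite !inE => /and3P[-> ->].
Qed.

Lemma bowtie_shell_nbrs_stable x : x \in bowtie_shell ->
  stable (nbrs (R :\: bowtie_shell) x).
Proof.
case/setUP=> [xK|]; first exact: near_clique_nbrs_stable near_clique_self xK.
rewrite inE => /andP[_ /existsP[L /andP[nL L2]]].
have [K3|] := ltnP 2 #|nbrs K x|.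
  have [T TN T3] := exists_subset_card K3.
  have xT : complete_to T x by move=> u /(subsetP TN); rewrite inE => /andP[].
  have xnT : x \notin T by apply/negP => /xT; rewrite adj_irr.
  have TK := subset_trans TN (nbrs_sub K x).
  apply: (@near_clique_nbrs_stable (x |: T)); last by rewrite setU11.
  rewrite /near_clique cardsU1 xnT T3 (cliqueU1 (cliqueS TK cK) xT) /=.
  by rewrite -T3 subset_leq_card // subsetI subsetUr.
rewrite leq_eqVlt => /orP[/eqP|K1].
  exact: two_nbrs_near_clique_stable near_clique_self.
apply: (two_nbrs_near_clique_stable nL); apply/eqP; rewrite eqn_leq L2 andbT.
exact: leq_trans (card_nbrs_near_clique x nL) K1.
Qed.

Lemma chi_bowtie_shell : chi bowtie_shell <= 4 + 4 * (4 * (omega R).+1 ^ 4).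
Proof.
have sub : bowtie_shell \subset closed_nbhd R K.
  apply: setUS; apply/subsetP => y.
  rewrite !inE => /andP[-> /existsP[L /andP[nL L2]]].
  have /card_gt0P[u] : 0 < #|nbrs K y|.
    by rewrite -ltnS (leq_trans L2) // card_nbrs_near_clique.
  by rewrite inE => /andP[uK yu]; apply/exists_inP; exists u.
apply: leq_trans (chiS sub) _; rewrite -[X in _ <= X + X * _]K4.
by apply: chi_closed_nbhd => v _; apply: chi_bowtie_nbrs.
Qed.
End Shell.

Lemma chi_bowtie_free c A : omega_lt_chi_leq G 4 c ->
  chi A <= 21 * c * (omega A).+1 ^ 4.
Proof.
move=> chi_c.
have chi_3 : omega_lt_chi_leq G 3 c by apply: omega_lt_chi_leqW chi_c.
pose Q := 4 + 4 * (4 * (omega A).+1 ^ 4).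
have [R RA /exists_clique_card[K [KR cK K4]]|U [UA U3 chiAU]] :=
    @chi_stable_nbrs_peel G A 4 Q c chi_3.
  exists (bowtie_shell K R); split.
  - by rewrite subUset KR; apply: setId_sub.
  - by rewrite setU_eq0 negb_and -card_gt0 K4.
  - apply: leq_trans (chi_bowtie_shell R K4) _.
    by rewrite leq_add2l !leq_pmul2l // leq_expn2r // ltnS omegaS.
  - exact: bowtie_shell_nbrs_stable.
apply: leq_trans (chi_setID A U) _; rewrite addnC (setIidPr UA).
apply: leq_trans (leq_add chiAU (chi_c U U3)) _; rewrite /Q.
have : 0 < (omega A).+1 ^ 4 by rewrite expn_gt0.
by move: (_ ^ 4) => a; nia.
Qed.
End Bowtie.

Lemma strongly_pollyanna_bowtie :
  strongly_pollyanna 3%:Z%R (induced_free bowtie).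
Proof.
move=> F /(@good_omega_lt_chi_leq _ 4)[//|c chi_c].
apply: (@poly_chi_bounded_monomial _ (21 * c) 4) => G [free FG] A.
exact: (chi_bowtie_free (induced_free_bowtie free) A (chi_c G FG)).
Qed.

(** * Substitution *)

Section Zones.
Variables w c e : nat.
Let d := 3 + c + 2 * e.

Definition zone (j : nat) : nat := w ^ d - w ^ d %/ 2 ^ j.+1.

Lemma zone_leq j : zone j <= w ^ d.
Proof. exact: leq_subr. Qed.

Lemma zone_mono : {homo zone : i j / i <= j}.
Proof.
by move=> i j ij; rewrite leq_sub2l // leq_div2l ?expn_gt0 // leq_exp2l.
Qed.

Lemma zone_room j : 0 < j ->
  zone j + 2 ^ c * (2 ^ j.+1) ^ e * (w %/ 2 ^ j) ^ d <= zone j.+1.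
Proof.
move=> j0; rewrite /zone [2 ^ j.+2]expnSr divnMA.
set F := (w %/ 2 ^ j) ^ d; set y := w ^ d %/ 2 ^ j.+1.
have yw : y <= w ^ d by rewrite leq_div.
suff: 2 * (2 ^ c * (2 ^ j.+1) ^ e * F) <= y by lia.
rewrite leq_divRL ?expn_gt0 //.
have Fw : F * 2 ^ (j * d) <= w ^ d.
  by rewrite expnM -expnMn leq_expn2r // leq_divM.
apply: leq_trans Fw.
rewrite (_ : _ * _ = F * 2 ^ (1 + c + j.+1 * e + j.+1)); last first.
  by rewrite -expnM !expnD expn1; lia.
by rewrite leq_mul2l leq_exp2l ?orbT // /d; apply/orP; right; nia.
Qed.

Lemma expn_sub_leq_zone b j : b <= w -> w < 2 ^ j.+1 * b ->
  (w - b) ^ d <= zone j.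
Proof.
move=> bw wb; rewrite /zone -/d (_ : d = (2 + c + 2 * e).+1) // [w ^ _.+1]expnS.
set v := w ^ _; set y := _ %/ _.
have yb : y <= b * v.
  rewrite -(mulKn (b * v) (_ : 0 < 2 ^ j.+1)) ?expn_gt0 // leq_div2r //.
  by rewrite mulnA leq_mul2r (ltnW wb) orbT.
have : (w - b) ^ (2 + c + 2 * e).+1 <= (w - b) * v.
  by rewrite expnS leq_mul // leq_expn2r // leq_subr.
rewrite mulnBl; move: (leq_mul bw (leqnn v)) => ?; lia.
Qed.
End Zones.

Section Substitution.
Variable G : sgraph.
Implicit Types (x y z h k m : G) (A B H L M X : {set G}) (r : G -> G).

Definition mixed z M : bool := touches M z && [exists b in M, ~~ adj z b].

Lemma mixedP z M :
  reflect (exists a b, [/\ a \in M, b \in M, adj z a & ~~ adj z b]) (mixed z M).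
Proof.
apply: (iffP andP) => [[/exists_inP[a aM za] /exists_inP[b bM zb]]|].
  by exists a, b.
by move=> [a [b [aM bM za zb]]]; split; apply/exists_inP; [exists a|exists b].
Qed.

Lemma not_mixed z M a b : ~~ mixed z M -> a \in M -> b \in M ->
  adj z a = adj z b.
Proof.
move=> z_not_mixed aM bM; apply/idP/idP => [za|zb]; apply: contraR z_not_mixed.
  by move=> zb; apply/mixedP; exists a, b.
by move=> za; apply/mixedP; exists b, a.
Qed.

Definition prime_set H : bool :=
  [forall M : {set G}, (M \proper H) && (1 < #|M|) ==>
    [exists z in H :\: M, mixed z M]].

Lemma prime_setP H : reflect
  (forall M, M \proper H -> 1 < #|M| -> exists2 z, z \in H :\: M & mixed z M)
  (prime_set H).
Proof.
apply: (iffP forallP) => prH M.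
  by move=> MH M1; apply/exists_inP; have := prH M; rewrite MH M1.
by apply/implyP => /andP[MH M1]; apply/exists_inP; apply: prH.
Qed.

(* [r] picks a representative in each block of a partition of [A] into
   modules. *)
Definition congruence A r : Prop := [/\ {in A, forall x, r x \in A},
  {in A, forall x, r (r x) = r x}
  & {in A &, forall x y, r x != r y -> adj x y = adj (r x) (r y)}].

Definition merge M m r x : G := if r x \in M then m else r x.

Lemma congruence_merge A r M m :
  congruence A r -> M \subset r @: A -> m \in M ->
  {in r @: A :\: M, forall z, ~~ mixed z M} -> congruence A (merge M m r).
Proof.
move=> [rA rr rc] /subsetP MrA mM not_mixed_M.
have [mA rm] : m \in A /\ r m = m.
  by have /imsetP[x xA ->] := MrA m mM; rewrite rr // rA.
have adj_m x y : x \in A -> y \in A -> r x \in M -> r y \notin M ->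
    adj x y = adj m (r y).
  move=> xA yA xM yM; rewrite rc //; last by apply: contraNneq yM => <-.
  rewrite ![adj _ (r y)]adj_sym; apply: (not_mixed (not_mixed_M (r y) _)) => //.
  by rewrite inE yM imset_f.
split.
- by move=> x xA; rewrite /merge; case: ifP => // _; apply: rA.
- move=> x xA; rewrite /merge.
  have [xM|xM] := boolP (r x \in M); first by rewrite rm mM.
  by rewrite rr // (negPf xM).
- move=> x y xA yA; rewrite /merge; case: ifP => xM; case: ifP => yM.
  + by rewrite eqxx.
  + by move=> _; apply: adj_m; rewrite ?yM.
  + by move=> _; rewrite adj_sym adj_m ?xM // adj_sym.
  + by move=> xy; apply: rc.
Qed.

(* A partition with the least number (at least 2) of blocks has a prime
   quotient, since a module of the quotient could be merged into one block. *)
Lemma prime_quotient A : 1 < #|A| ->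
  exists r, [/\ congruence A r, 1 < #|r @: A| & prime_set (r @: A)].
Proof.
move=> A1; suff quotient S r : r @: A = S -> congruence A r -> 1 < #|S| ->
    exists r, [/\ congruence A r, 1 < #|r @: A| & prime_set (r @: A)].
  by apply: (quotient A id); [apply: imset_id|split|].
elim/proper_set_ind: S r => S IHS r rA_S rP S1.
have [prS|] := boolP (prime_set S); first by exists r; rewrite rA_S.
rewrite negb_forall => /existsP[M]; rewrite negb_imply.
move=> /andP[/andP[/properP[MS [h hS hM]] M1]].
rewrite negb_exists_in -rA_S => /forall_inP not_mixed_M.
have [m [m' [mM m'M mm']]] := card_gt1P M1; rewrite -rA_S in MS hS.
have [rA rr _] := rP; have rS x : x \in r @: A -> x \in A /\ r x = x.
  by move=> /imsetP[y yA ->]; rewrite rr // rA.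
have [mA rm] := rS m (subsetP MS m mM); have [hA rh] := rS h hS.
apply: (IHS _ _ (merge M m r) (erefl _)).
- apply/properP; rewrite -rA_S; split.
    apply/subsetP => _ /imsetP[x xA ->]; rewrite /merge.
    by case: ifP => _; [apply: (subsetP MS)|apply: imset_f].
  exists m'; first exact: (subsetP MS).
  apply/imsetP => -[x xA]; rewrite /merge; case: ifP => xM m'_eq.
    by rewrite m'_eq eqxx in mm'.
  by rewrite -m'_eq m'M in xM.
- exact: congruence_merge.
- apply/card_gt1P; exists m, h; split; last by apply: contraNneq hM => <-.
    by apply/imsetP; exists m; rewrite // /merge rm mM.
  by apply/imsetP; exists h; rewrite // /merge rh (negPf hM).
Qed.

Lemma exists_classwise_colouring (C : eqType) (g : G -> C) A :
  exists f : G -> nat,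
  {in A, forall x, f x < chi [set y in A | g y == g x]} /\
  {in A &, forall x y, g x = g y -> adj x y -> f x <> f y}.
Proof.
have /fin_all_exists[f fP] := @chi_colouring G.
exists (fun x => f [set y in A | g y == g x] x).
split=> [x xA|x y xA yA gxy xy].
  by have [+ _] := fP [set y in A | g y == g x]; apply; rewrite inE xA /=.
have [_] := fP [set y in A | g y == g x]; rewrite gxy; apply=> //.
  by rewrite inE xA gxy /=.
by rewrite inE yA /=.
Qed.

Lemma chi_stacked_levels A (lev f : G -> nat) (bottom : nat -> nat) n :
  {homo bottom : i j / i <= j} -> (forall j, bottom j <= n) ->
  (forall j, 0 < j ->
    bottom j + chi [set x in A | lev x == j] <= bottom j.+1) ->
  {in A, forall x, lev x = 0 -> f x < n} ->
  {in A &, forall x y, lev x = 0 -> adj x y ->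
     if lev y == 0 then f x <> f y else f x < bottom (lev y)} ->
  chi A <= n.
Proof.
move=> bottom_mono bottom_n room fn f_adj.
have [k [kA kP]] := exists_classwise_colouring lev A.
pose F x := if lev x == 0 then f x else bottom (lev x) + k x.
have F_top x : x \in A -> lev x != 0 -> F x < bottom (lev x).+1.
  move=> xA x0; rewrite /F (negPf x0) (leq_trans _ (room _ _)) ?lt0n //.
  by rewrite ltn_add2l kA.
apply/chiP; exists F; split=> [x xA|x y xA yA].
  have [x0|x0] := eqVneq (lev x) 0; first by rewrite /F x0 fn.
  exact: leq_trans (F_top x xA x0) (bottom_n _).
wlog le_xy : x y xA yA / lev x <= lev y.
  move=> wlog_le.
  have [|/ltnW le xy /esym] := leqP (lev x) (lev y); first exact: wlog_le.
  by apply: wlog_le; rewrite // adj_sym.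
move=> xy; have [x0|x0] := eqVneq (lev x) 0.
  have := f_adj x y xA yA x0 xy; rewrite /F x0 eqxx; case: ifP => // _ fx e.
  by rewrite e ltnNge leq_addr in fx.
have y0 : lev y != 0 by rewrite -lt0n (leq_trans _ le_xy) // lt0n.
move: le_xy; rewrite leq_eqVlt => /orP[/eqP e|lt_xy].
  by rewrite /F -e (negPf x0) => /addnI; apply: kP.
apply/eqP; rewrite ltn_eqF // (leq_trans (F_top x xA x0)) //.
by rewrite /F (negPf y0) (leq_trans (bottom_mono _ _ lt_xy)) ?leq_addr.
Qed.

Section Quotient.
Variables (A : {set G}) (r : G -> G).
Hypothesis rP : congruence A r.

Definition block h : {set G} := [set x in A | r x == h].

Lemma mem_block x : x \in A -> x \in block (r x).
Proof. by move=> xA; rewrite inE xA eqxx. Qed.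

Lemma block_sub h : block h \subset A.
Proof. exact: setId_sub. Qed.

Lemma chi_union_blocks B n : {in B, forall h, chi (block h) <= n} ->
  chi [set x in A | r x \in B] <= chi B * n.
Proof.
move=> block_n; have [_ _ rc] := rP; have [k [kB kP]] := chi_colouring B.
have [f [fA fP]] := exists_classwise_colouring r A.
have fn x : x \in A -> r x \in B -> f x < n.
  by move=> xA /block_n; apply: leq_trans; apply: fA.
apply/chiP; exists (fun x => k (r x) * n + f x); split=> [x|x y].
  rewrite inE => /andP[xA xB]; apply: (@leq_trans ((k (r x)).+1 * n)).
    by rewrite mulSn addnC ltn_add2r fn.
  by rewrite leq_mul2r kB ?orbT.
rewrite !inE => /andP[xA xB] /andP[yA yB] xy.
have [e|nxy] := eqVneq (r x) (r y); first by rewrite e => /addnI; apply: fP.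
have n0 : 0 < n by apply: leq_ltn_trans (fn x xA xB).
move=> /(congr1 (divn^~ n)); rewrite !divnMDl // !divn_small ?fn // !addn0.
by apply: kP; rewrite -?rc.
Qed.

Lemma sum_omega_blocks L : L \subset r @: A -> clique L ->
  \sum_(h in L) omega (block h) <= omega A.
Proof.
move=> LH /cliqueP cL; have [_ _ rc] := rP.
have /fin_all_exists[K KP] := fun h => exists_maximum_clique (block h).
have Kr h x : x \in K h -> x \in A /\ r x = h.
  by have [/subsetP KB _ _] := KP h; move=> /KB; rewrite inE => /andP[xA /eqP].
pose U := \bigcup_(h in L) K h.
have UA : U \subset A by apply/bigcupsP => h _; apply/subsetP => x /Kr[].
have cU : clique U.
  apply/cliqueP => x y /bigcupP[h hL xh] /bigcupP[k kL yk] xy.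
  have [[xA rx] [yA ry]] := (Kr _ _ xh, Kr _ _ yk).
  have [e|hk] := eqVneq h k.
    by rewrite -e in yk; have [_ /cliqueP cK _] := KP h; apply: cK.
  by rewrite rc ?rx ?ry //; apply: cL.
apply: leq_trans (leq_omega UA cU).
rewrite -sum1_card [leqRHS](partition_big r (mem L)) /=; last first.
  by move=> x /bigcupP[h hL /Kr[_ ->]].
apply: leq_sum => h hL; have [_ _ <-] := KP h.
rewrite sum1dep_card subset_leq_card //; apply/subsetP => x xh.
have [xA rx] := Kr _ _ xh; rewrite inE rx eqxx andbT.
by apply/bigcupP; exists h.
Qed.

Definition weight h : nat := omega (block h).

Definition level h : nat := trunc_log 2 (omega A %/ weight h).

Lemma weight_leq h : weight h <= omega A.
Proof. exact/omegaS/block_sub. Qed.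

Lemma level_bounds h : h \in r @: A ->
  2 ^ level h * weight h <= omega A < 2 ^ (level h).+1 * weight h.
Proof.
move=> /imsetP[x xA ->].
have W0 : 0 < weight (r x) := omega_gt0 (mem_block xA).
have w0 : 0 < omega A %/ weight (r x) by rewrite divn_gt0 // weight_leq.
have /andP[lower upper] := trunc_log_bounds (leqnn 2) w0.
by rewrite -leq_divRL // lower -ltn_divLR.
Qed.

Lemma weight_adj h k : h \in r @: A -> k \in r @: A -> adj h k ->
  weight h + weight k <= omega A.
Proof.
move=> hH kH hk; have := @sum_omega_blocks [set h; k].
rewrite big_setU1 ?big_set1; last by rewrite inE adj_neq.
by apply; [rewrite subUset !sub1set hH|apply: clique2].
Qed.

Lemma omega_level j : omega [set h in r @: A | level h == j] < 2 ^ j.+1.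
Proof.
have [L [/subsetP LH cL <-]] :=
  exists_maximum_clique [set h in r @: A | level h == j].
have LP h : h \in L -> h \in r @: A /\ level h = j.
  by move=> /LH; rewrite inE => /andP[hH /eqP].
have sumL : \sum_(h in L) weight h <= omega A.
  by apply: sum_omega_blocks => //; apply/subsetP => h /LP[].
have : #|L| * (omega A).+1 <= 2 ^ j.+1 * omega A.
  apply: (@leq_trans (2 ^ j.+1 * \sum_(h in L) weight h)); last first.
    by rewrite leq_mul.
  rewrite -sum_nat_const [leqRHS]big_distrr /=; apply: leq_sum => h /LP[hH <-].
  by have /andP[] := level_bounds hH.
rewrite -(ltn_pmul2r (ltn0Sn (omega A))) => /leq_ltn_trans; apply.
by rewrite ltn_pmul2l ?expn_gt0.
Qed.

Variables c e : nat.
Let d := 3 + c + 2 * e.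
Hypothesis chi_quotient : forall B, B \subset r @: A ->
  chi B <= 2 ^ c * omega B ^ e.
Hypothesis chi_block : {in r @: A, forall h, chi (block h) <= weight h ^ d}.

Lemma chi_level j : chi [set x in A | level (r x) == j]
  <= 2 ^ c * (2 ^ j.+1) ^ e * (omega A %/ 2 ^ j) ^ d.
Proof.
pose H := [set h in r @: A | level h == j].
have HA : H \subset r @: A by apply: setId_sub.
have -> : [set x in A | level (r x) == j] = [set x in A | r x \in H].
  apply/setP => x; rewrite !inE.
  by have [xA|//] := boolP (x \in A); rewrite imset_f.
apply: leq_trans
  (chi_union_blocks (_ : {in H, forall h, _ <= (omega A %/ 2 ^ j) ^ d})) _.
  move=> h; rewrite inE => /andP[hH /eqP hj]; apply: leq_trans (chi_block hH) _.
  rewrite leq_expn2r // leq_divRL ?expn_gt0 // mulnC -hj.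
  by have /andP[] := level_bounds hH.
rewrite leq_mul // (leq_trans (chi_quotient HA)) // leq_mul // leq_expn2r //.
exact/ltnW/omega_level.
Qed.

(* Blocks of level [0] are pairwise non-adjacent and are coloured from [0]
   upwards.  Level [j > 0] uses the colours from [zone j] to [zone j.+1], which
   lie above all colours of adjacent blocks of level [0]: these have clique
   number at most [omega A - b] when adjacent to a block of clique number
   [b]. *)
Lemma chi_of_quotient : chi A <= omega A ^ d.
Proof.
have [_ _ rc] := rP; have rH x : x \in A -> r x \in r @: A by apply: imset_f.
have [f [fA fP]] := exists_classwise_colouring r A.
have f_weight x : x \in A -> f x < weight (r x) ^ d.
  by move=> xA; apply: leq_trans (fA x xA) (chi_block (rH x xA)).
apply: (@chi_stacked_levels A (level \o r) f (zone (omega A) c e)) => /=.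
- exact: zone_mono.
- exact: zone_leq.
- move=> j j0; apply: leq_trans (zone_room (omega A) c e j0).
  by rewrite leq_add2l chi_level.
- move=> x xA _; apply: leq_trans (f_weight x xA) _.
  by rewrite leq_expn2r // weight_leq.
move=> x y xA yA x0 xy; case: ifP => [/eqP y0|/negbT y0].
  apply: fP => //; apply/eqP; apply: contraTT xy => nxy; rewrite rc //.
  have := omega_leq1_stable (omega_level 0).
  by move=> /stableP; apply; rewrite inE rH ?x0 ?y0.
have nxy : r x != r y by apply: contraNneq y0 => <-; rewrite x0.
rewrite rc // in xy.
have /andP[_ wy] := level_bounds (rH y yA).
apply: leq_trans (f_weight x xA)
  (leq_trans _ (expn_sub_leq_zone c e (weight_leq _) wy)).
by rewrite leq_expn2r // leq_subRL ?weight_leq // addnC weight_adj ?rH.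
Qed.
End Quotient.

Lemma chi_of_prime A c e :
  (forall H B, H \subset A -> prime_set H -> B \subset H ->
     chi B <= 2 ^ c * omega B ^ e) ->
  chi A <= omega A ^ (3 + c + 2 * e).
Proof.
elim/proper_set_ind: A => A IHA chi_prime; have [A1|A1] := leqP #|A| 1.
  have [->|[x /omega_gt0 w0]] := set_0Vmem A; first by rewrite chi0.
  by apply: leq_trans (chi_leq_card A) (leq_trans A1 _); rewrite expn_gt0 w0.
have [r [rP H1 prH]] := prime_quotient A1; have [rA _ _] := rP.
have HA : r @: A \subset A by apply/subsetP => _ /imsetP[x xA ->]; apply: rA.
apply: (chi_of_quotient rP) => [B BH|h hH]; first exact: chi_prime BH.
have bA := block_sub A r h.
apply: IHA => [|H B Hb]; last by apply: chi_prime; apply: subset_trans bA.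
have /card_gt1P[k [k' [/imsetP[x xA ->] /imsetP[y yA ->] rxy]]] := H1.
apply/properP; split=> //; have [rx|rx] := eqVneq (r x) h.
  by exists y; rewrite // inE yA /= -rx eq_sym.
by exists x; rewrite // inE xA.
Qed.
End Substitution.

(** * Bulls *)

Section SplitSets.
Variable G : sgraph.
Implicit Types (x y : G) (A B Q X : {set G}).

Definition split_set X : bool :=
  [exists Q : {set G}, clique Q && stable (X :\: Q)].

Lemma split_setI X Q : clique Q -> stable (X :\: Q) -> split_set X.
Proof. by move=> cQ sXQ; apply/existsP; exists Q; rewrite cQ. Qed.

Lemma split_setS A B : B \subset A -> split_set A -> split_set B.
Proof.
move=> BA /existsP[Q /andP[cQ sAQ]]; apply: (split_setI cQ).
exact: stableS (setSD Q BA) sAQ.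
Qed.

Lemma clique_card_leq1 A : #|A| <= 1 -> clique A.
Proof.
move=> /card_le1_eqP A1; apply/cliqueP => x y xA /(A1 x y xA) ->.
by rewrite eqxx.
Qed.

Lemma stable_card_leq1 A : #|A| <= 1 -> stable A.
Proof.
move=> /card_le1_eqP A1; apply/stableP => x y xA /(A1 x y xA) ->.
by rewrite adj_irr.
Qed.

Lemma chi_split_set A : split_set A -> chi A <= 2 * omega A.
Proof.
move=> /existsP[Q /andP[cQ sAQ]].
have [->|[x /omega_gt0 w0]] := set_0Vmem A; first by rewrite chi0.
apply: leq_trans (chi_setID A Q) _; rewrite mul2n -addnn leq_add //.
  apply: leq_trans (chi_leq_card _) (leq_omega (subsetIl A Q) _).
  exact: cliqueS (subsetIr A Q) cQ.
exact: leq_trans (chi_stable sAQ) w0.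
Qed.
End SplitSets.

Section RelativeConnectivity.
Variable G : sgraph.
Implicit Types (x y z m p q : G) (P Q X Y : {set G}) (c : bool).

(* Connected for [c = true], connected in the complement for [c = false]. *)
Definition connected_by c X : Prop := forall P,
  X :&: P != set0 -> X :\: P != set0 ->
  exists x y, [/\ x \in X :&: P, y \in X :\: P & adj x y = c].

Lemma connected_byU1 c X z x :
  connected_by c X -> x \in X -> adj z x = c -> connected_by c (z |: X).
Proof.
move=> cX xX zx P /set0Pn[a /setIP[aX aP]] /set0Pn[b /setDP[bX bP]].
have [XP0|XP] := eqVneq (X :&: P) set0.
  have X_notin_P y : y \in X -> y \notin P.
    by move=> yX; apply/negP => yP; move/setP/(_ y): XP0; rewrite !inE yX yP.
  have az : a = z by case/setU1P: aX => // /X_notin_P; rewrite aP.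
  by exists z, x; rewrite !inE -az aP eqxx xX orbT X_notin_P // az.
have [XP0|XnP] := eqVneq (X :\: P) set0.
  have X_in_P y : y \in X -> y \in P by apply/subsetP; rewrite -setD_eq0 XP0.
  have bz : b = z by case/setU1P: bX => // /X_in_P; rewrite (negPf bP).
  by exists x, z; rewrite !inE -bz bP eqxx xX orbT X_in_P // adj_sym bz.
have [u [v [/setIP[uX uP] /setDP[vX vP] uv]]] := cX P XP XnP.
by exists u, v; rewrite !inE uX uP vX vP !orbT.
Qed.

Lemma connected_by2 c x y : adj x y = c -> connected_by c [set x; y].
Proof.
move=> xy P /set0Pn[a /setIP[/set2P ha aP]] /set0Pn[b /setDP[/set2P hb bP]].
exists a, b; rewrite !inE aP bP; case: ha hb aP bP => -> [] -> aP bP;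
  by rewrite ?eqxx ?orbT //; first [rewrite aP in bP|rewrite adj_sym].
Qed.

Lemma connected_by_mixed c X z : connected_by c X -> mixed z X ->
  exists p q, [/\ p \in X, q \in X, adj z p, ~~ adj z q & adj p q = c].
Proof.
move=> cX /mixedP[a [b [aX bX za zb]]].
have [||p [q []]] := cX [set u | adj z u].
- by apply/set0Pn; exists a; rewrite !inE aX.
- by apply/set0Pn; exists b; rewrite !inE zb.
by rewrite !inE => /andP[pX zp] /andP[zq qX] pq; exists p, q.
Qed.

Lemma prime_homogeneous_card_leq1 X Q c : prime_set X -> X :\: Q != set0 ->
  {in X :&: Q & X :\: Q, forall u v, adj u v = c} -> #|X :&: Q| <= 1.
Proof.
move=> /prime_setP prX /set0Pn[v /setDP[vX vQ]] hom.
rewrite leqNgt; apply/negP => big.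
have XQ_proper : X :&: Q \proper X.
  by apply/properP; split; [apply: subsetIl|exists v; rewrite // inE vX].
have [z zXQ /mixedP[p [q [pXQ qXQ zp zq]]]] := prX _ XQ_proper big.
rewrite setDIr setDv set0U in zXQ.
by move: zp zq; rewrite (adj_sym z p) (adj_sym z q) !hom // => ->.
Qed.

Lemma prime_connected_by c X : prime_set X -> ~~ split_set X ->
  connected_by c X.
Proof.
move=> prX nsX P XP XnP.
have [/existsP[x /existsP[y /and3P[xP yP /eqP xy]]]|no_edge] := boolP
    [exists x, exists y, [&& x \in X :&: P, y \in X :\: P & adj x y == c]].
  by exists x, y.
have cross : {in X :&: P & X :\: P, forall x y, adj x y = ~~ c}.
  move=> x y xP yP; apply/esym/addbP; rewrite -negb_eqb.
  apply: contra no_edge => cxy; apply/existsP; exists x.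
  by apply/existsP; exists y; rewrite xP yP eq_sym.
have P1 := prime_homogeneous_card_leq1 prX XnP cross.
have nP1 : #|X :\: P| <= 1.
  rewrite setDE; apply: (@prime_homogeneous_card_leq1 X (~: P) (~~ c) prX).
    by rewrite setDE setCK.
  by rewrite setDE setCK => x y xP yP; rewrite adj_sym cross // setDE.
case/negP: nsX; apply: (split_setI (clique_card_leq1 P1)).
by rewrite setDIr setDv set0U stable_card_leq1.
Qed.

Definition side c X m : {set G} := [set x in X | adj m x == c].

(* Otherwise a maximal such [Y] would be a module. *)
Lemma prime_side_connected_leq1 c X m Y : prime_set X ->
  side (~~ c) X m != set0 ->
  {in side c X m & side c X m & side (~~ c) X m,
    forall p p' q, adj p p' = c -> adj p q -> adj p' q} ->
  Y \subset side c X m -> connected_by c Y -> #|Y| <= 1.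
Proof.
move=> /prime_setP prX /set0Pn[q0]; rewrite inE => /andP[q0X /eqP mq0] hom.
move eqD : (side c X m :\: Y) => D.
elim/proper_set_ind: D Y eqD => D IHD Y eqD YC cY.
rewrite leqNgt; apply/negP => Y1; have YX : Y \subset X.
  by apply: subset_trans YC _; apply: setId_sub.
have [|z /setDP[zX zY] z_mixed] := prX Y _ Y1.
  apply/properP; split=> //; exists q0 => //; apply/negP => /(subsetP YC).
  by rewrite inE mq0 => /andP[_]; case: (c).
have [a [b [aY bY za zb ab]]] := connected_by_mixed cY z_mixed.
have [zC|zC] := boolP (z \in side c X m); last first.
  have zC' : z \in side (~~ c) X m.
    by move: zC; rewrite !inE zX /= negb_eqb => /addbP <-; rewrite negbK.
  have := hom a b z (subsetP YC a aY) (subsetP YC b bY) zC' ab.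
  by rewrite ![adj _ z]adj_sym za (negPf zb) => /(_ isT).
have [x xY zx] : exists2 x, x \in Y & adj z x = c.
  by case: (c); [exists a|exists b; rewrite ?(negPf zb)].
have : #|z |: Y| <= 1.
  apply: (IHD (side c X m :\: (z |: Y))) => //.
  - rewrite -eqD setUC -setDDl.
    apply: (@properDI _ _ _ z); last by rewrite set11.
    by rewrite inE zY.
  - by rewrite subUset sub1set zC.
  - exact: connected_byU1 zx.
by rewrite cardsU1 zY add1n ltnS leqNgt (ltnW Y1).
Qed.

Lemma prime_side_homogeneous c X m : prime_set X -> side (~~ c) X m != set0 ->
  {in side c X m & side c X m & side (~~ c) X m,
    forall p p' q, adj p p' = c -> adj p q -> adj p' q} ->
  {in side c X m &, forall p p', p != p' -> adj p p' = ~~ c}.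
Proof.
move=> prX ne hom p p' pC p'C pp'; apply/esym/addbP; rewrite -negb_eqb.
apply/negP => /eqP/esym/connected_by2 c2.
have := prime_side_connected_leq1 prX ne hom _ c2.
by rewrite cards2 pp' subUset !sub1set pC p'C => /(_ isT).
Qed.
End RelativeConnectivity.

Section BullFree.
Variable G : sgraph.
Implicit Types (a b s t u v w x y z : G) (A B D K L R S X : {set G})
  (l : seq G).

Definition bull_free : Prop := forall a b c d e : G,
  adj a b -> adj a c -> adj b c -> adj a d -> adj b e ->
  ~~ adj c d -> ~~ adj c e -> ~~ adj b d -> ~~ adj a e -> adj d e.

Lemma bull_no_false_twins (i j : bull) : adj i =1 adj j -> i = j.
Proof.
move=> twins; apply: val_inj.
have := (twins (@Ordinal 5 0 isT), twins (@Ordinal 5 1 isT),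
         twins (@Ordinal 5 2 isT), twins (@Ordinal 5 3 isT),
         twins (@Ordinal 5 4 isT)).
by case: i j {twins} => [[|[|[|[|[|//]]]]] ?] [[|[|[|[|[|//]]]]] ?] [[[[]]]].
Qed.

Lemma induced_free_bull : induced_free bull G -> bull_free.
Proof.
move=> free a b c d e ab ac bc ad be cd ce bd ae; apply/negPn/negP => de.
pose f (i : bull) : G := nth a [:: a; b; c; d; e] i.
have f_adj : {mono f : i j / adj i j}.
  have E := (adj_irr, ab, ac, bc, ad, be,
             negPf cd, negPf ce, negPf bd, negPf ae, negPf de).
  case=> [[|[|[|[|[|//]]]]] ?] [[|[|[|[|[|//]]]]] ?];
    by rewrite /f /= ?E // adj_sym ?E.
apply: (induced_free_no_embedding free f_adj).
exact: no_false_twins_mono_inj bull_no_false_twins f_adj.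
Qed.

Hypothesis free : bull_free.

Section CentreAnticentre.
Variables (X : {set G}) (s : G).
Hypotheses (X_prime : prime_set X) (X_nonsplit : ~~ split_set X).
Hypothesis sX : anticomplete_to X s.

Lemma mixed_nonadj_anticentre w y : complete_to X w -> ~~ adj w y ->
  mixed y X -> ~~ adj s y.
Proof.
move=> wX wy /mixedP[p0 [q0 [p0X q0X yp0 yq0]]].
apply: contra X_nonsplit => sy; apply: (@split_setI _ X (side false X y)).
  apply/cliqueP; apply: prime_side_homogeneous => //.
    by apply/set0Pn; exists p0; rewrite inE p0X yp0.
  move=> q q' p; rewrite !inE => /andP[qX /eqP/negbT yq].
  move=> /andP[q'X /eqP/negbT yq'] /andP[pX /eqP yp] /negbT qq' qp.
  apply/negPn/negP => q'p.
  suff: adj q' y by rewrite adj_sym (negPf yq').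
  by apply: (free (a := w) (b := p) (c := q)) => //; rewrite ?wX // adj_sym.
have -> : X :\: side false X y = side true X y.
  by apply/setP => x; rewrite !inE; case: (x \in X); case: (adj y x).
apply/stableP => p p' pY p'Y.
have [->|pp'] := eqVneq p p'; first by rewrite adj_irr.
suff -> : adj p p' = ~~ true by [].
apply: (@prime_side_homogeneous _ true X y) => //.
  by apply/set0Pn; exists q0; rewrite inE q0X (negPf yq0).
move=> u v q; rewrite !inE.
move=> /andP[uX /eqP yu] /andP[vX /eqP yv] /andP[qX /eqP/negbT yq] uv uq.
apply/negPn/negP => vq; suff: adj s q by rewrite (negPf (sX qX)).
by apply: (free (a := y) (b := u) (c := v)) => //; rewrite adj_sym // sX.
Qed.

Lemma mixed_nonadj_centre w y : complete_to X w -> ~~ adj w y ->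
  mixed y X -> ~~ adj s w.
Proof.
move=> wX wy yX; have sy := mixed_nonadj_anticentre wX wy yX.
have [p [q [pX qX yp yq pq]]] :=
  connected_by_mixed (prime_connected_by true X_prime X_nonsplit) yX.
apply: contra sy => sw; rewrite adj_sym.
have [wp wq sp sq] := And4 (wX p pX) (wX q qX) (sX pX) (sX qX).
by apply: (free (a := p) (b := w) (c := q)) => //; rewrite adj_sym.
Qed.

Definition span l : {set G} := X :|: [set z in l].

Lemma in_span l z : (z \in span l) = (z \in X) || (z \in l).
Proof. by rewrite !inE. Qed.

Lemma span_cons z l : span (z :: l) = z |: span l.
Proof. by apply/setP => u; rewrite !inE orbCA. Qed.

Fixpoint mixing_chain l : bool :=
  if l is y :: l' then mixed y (span l') && mixing_chain l' else true.

Lemma mixing_chain_catr l1 l2 : mixing_chain (l1 ++ l2) -> mixing_chain l2.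
Proof. by elim: l1 => //= y l1 IH /andP[_ /IH]. Qed.

Lemma span_connected_by c l : mixing_chain l -> connected_by c (span l).
Proof.
elim: l => [_|z l IHl /= /andP[/mixedP[a [b [al bl za zb]]] /IHl cl]].
  rewrite (_ : span [::] = X); first exact: prime_connected_by.
  by apply/setP => u; rewrite in_span orbF.
rewrite span_cons; case: c {IHl} cl => cl; first exact: connected_byU1 al za.
exact: connected_byU1 bl (negbTE zb).
Qed.

Lemma span_anticomplete l w y : mixing_chain l -> complete_to (span l) w ->
  ~~ adj w y -> anticomplete_to X y -> anticomplete_to (span l) y.
Proof.
elim: l => [_ _ _ yX z|z l IHl /= /andP[z_mixed cl] wl wy yX u].
  by rewrite in_span orbF; apply: yX.
have wl' : complete_to (span l) w.
  by move=> v vl; apply: wl; rewrite span_cons setU1r.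
have yl := IHl cl wl' wy yX.
rewrite span_cons => /setU1P[->|]; last exact: yl.
apply/negP => yz.
have [a [b [al bl za zb ab]]] :=
  connected_by_mixed (span_connected_by false cl) z_mixed.
suff: adj b y by rewrite adj_sym (negPf (yl b bl)).
have wz : adj w z by apply: wl; rewrite span_cons setU11.
have [wa wb] := (wl' a al, wl' b bl); have [ya yb] := (yl a al, yl b bl).
by apply: (free (a := w) (b := z) (c := a)); rewrite ?(negbT ab) // adj_sym.
Qed.

Lemma mixed_or_complete l w y : mixed y (span l) -> mixing_chain l ->
  complete_to (span l) w -> ~~ adj w y -> mixed y X \/ complete_to X y.
Proof.
move=> y_mixed cl wl wy.
have [|not_mixed_X] := boolP (mixed y X); [by left|right].
apply/forall_inP; apply: contraR not_mixed_X => /forall_inPn[x xX yx].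
apply/andP; split; last by apply/exists_inP; exists x.
apply: contraT => /touchesPn/(span_anticomplete cl wl wy) yl.
by have /mixedP[a [b [al _ ya _]]] := y_mixed; have := yl a al; rewrite ya.
Qed.

(* Unrolling the induction, [w] and the successive [y]'s induce a path in the
   complement, and non-adjacency to [s] propagates along it towards [w]. *)
Lemma chain_anticentre l w y :
  mixing_chain (y :: l) -> complete_to (span l) w -> ~~ adj w y ->
  [/\ ~~ adj s w, ~~ adj s y & exists2 x, x \in X & adj y x].
Proof.
have [n] := ubnP (size l); elim: n l w y => // n IHn l w y; rewrite ltnS => ln.
move=> /= /andP[y_mixed cl] wl wy.
have wX : complete_to X w by move=> x xX; apply: wl; rewrite in_span xX.
have [yX|yX] := mixed_or_complete y_mixed cl wl wy.
  have /mixedP[x [_ [xX _ yx _]]] := yX; split; last by exists x.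
    exact: mixed_nonadj_centre wy yX.
  exact: mixed_nonadj_anticentre wX wy yX.
have [|z [l1 [l2 [el yz /allP yl2]]]] := @split_last_not _ (adj y) l.
  have /mixedP[_ [b [_ + _ yb]]] := y_mixed; rewrite in_span.
  by case/orP => [/yX|bl]; [rewrite (negPf yb)|apply/allPn; exists b].
have cz : mixing_chain (z :: l2) by move: cl; rewrite el => /mixing_chain_catr.
have [||sy sz [x xX zx]] := IHn l2 y z _ cz _ yz.
- by apply: leq_trans ln; rewrite el size_cat /= addnS ltnS leq_addl.
- by move=> u; rewrite in_span => /orP[/yX|/yl2].
have [wx yx sx] := And3 (wX x xX) (yX x xX) (sX xX).
split=> //; last by exists x.
apply: contra sy => sw.
have wz : adj w z by apply: wl; rewrite in_span el mem_cat mem_head !orbT.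
by apply: (free (a := w) (b := x) (c := z)) => //; rewrite adj_sym.
Qed.
End CentreAnticentre.

Lemma prime_centre_anticentre_split A X t s : prime_set A -> X \subset A ->
  prime_set X -> t \in A -> adj t s -> complete_to X t -> anticomplete_to X s ->
  split_set X.
Proof.
move=> /prime_setP prA XA prX tA ts tX sX; apply: contraT => nsX; exfalso.
have X2 : 1 < #|X|.
  rewrite ltnNge; apply: contra nsX => X1; apply: (@split_setI _ X set0).
    exact: clique0.
  by rewrite setD0; apply: stable_card_leq1.
suff no_chain D l : A :\: span X l = D -> mixing_chain X l ->
    span X l \subset A -> ~ complete_to (span X l) t.
  have span0 : span X [::] = X by apply/setP => u; rewrite in_span orbF.
  by apply: (no_chain _ [::] (erefl _)); rewrite // span0.
elim/proper_set_ind: D l => D IHD l eqD cl lA tl.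
have [||z /setDP[zA zl] z_mixed] := prA (span X l).
- apply/properP; split=> //; exists t => //.
  by apply/negP => /tl; rewrite adj_irr.
- by apply: leq_trans X2 _; apply: subset_leq_card; apply: subsetUl.
have cz : mixing_chain X (z :: l) by rewrite /= z_mixed.
have [tz|tz] := boolP (adj t z); last first.
  have [] := chain_anticentre prX nsX sX cz tl tz.
  by rewrite adj_sym ts.
apply: (IHD (A :\: span X (z :: l)) _ (z :: l)) => //.
- rewrite -eqD span_cons setUC -setDDl.
  apply: (@properDI _ _ _ z); last by rewrite set11.
  by rewrite inE zl.
- by rewrite span_cons subUset sub1set zA.
- by move=> u; rewrite span_cons => /setU1P[->|/tl].
Qed.

Lemma chi_centre_anticentre A D t s : prime_set A -> D \subset A -> t \in A ->
  adj t s -> complete_to D t -> anticomplete_to D s -> chi D <= omega D ^ 6.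
Proof.
move=> prA DA tA ts tD sD; apply: (@chi_of_prime _ D 1 1) => H B HD prH BH.
rewrite expn1; apply: chi_split_set; apply: split_setS BH _.
apply: (@prime_centre_anticentre_split A H t s) => //.
- exact: subset_trans DA.
- by move=> x /(subsetP HD)/tD.
- by move=> x /(subsetP HD)/sD.
Qed.

(* Two vertices with incomparable, intersecting sets of non-neighbours in [K]
   are adjacent, since otherwise they form a bull with a triangle of [K]. *)
Lemma incomparable_non_nbrs_adj K x y u : clique K ->
  #|non_nbrs K x| = #|non_nbrs K y| -> non_nbrs K x != non_nbrs K y ->
  u \in non_nbrs K x -> u \in non_nbrs K y -> adj x y.
Proof.
move=> /cliqueP cK eq_card ne.
have not_sub (P Q : {set G}) : #|P| = #|Q| -> P != Q ->
    exists2 a : G, a \in Q & a \notin P.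
  move=> PQ; rewrite eq_sym => neQP; apply/subsetPn; apply: contra neQP => QP.
  by rewrite eqEcard QP PQ leqnn.
have [a aNy aNx] := not_sub _ _ eq_card ne.
have [b bNx bNy] : exists2 b : G, b \in non_nbrs K x & b \notin non_nbrs K y.
  by apply: not_sub; rewrite // eq_sym.
move: aNy aNx bNx bNy; rewrite !inE => /andP[aK ya].
rewrite aK /= negbK => xa /andP[bK xb]; rewrite bK /= negbK => yb.
move=> /andP[uK xu] /andP[_ yu].
have [ab au bu] : [/\ adj a b, adj a u & adj b u].
  split; apply: cK => //.
  - by apply: contraNneq xb => <-.
  - by apply: contraNneq xu => <-.
  - by apply: contraNneq yu => <-.
by apply: (free ab au bu) => //; rewrite adj_sym.
Qed.

Section MaximumClique.
Variables R K : {set G}.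
Hypothesis maxK : maximum_clique R K.

Definition non_nbr_sets : {set {set G}} := [set non_nbrs K x | x in R].

Lemma card_non_nbr_sets_through u n :
  #|[set S in non_nbr_sets | (u \in S) && (#|S| == n)]| <= #|K|.
Proof.
have [_ cK ->] := maxK; set F := [set S in _ | _].
have FP S : S \in F -> exists x, x \in R /\ non_nbrs K x = S.
  by rewrite inE => /andP[/imsetP[x xR ->] _]; exists x.
have [->|[S0 /FP[x0 [x0R _]]]] := set_0Vmem F; first by rewrite cards0.
have /fin_all_exists[rep repP] S : exists x, S \in F ->
    x \in R /\ non_nbrs K x = S.
  by have [/FP[x xP]|_] := boolP (S \in F); [exists x|exists x0].
have rep_inj : {in F &, injective rep}.
  by move=> S S' /repP[_ {2}<-] /repP[_ {2}<-] ->.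
rewrite -(card_in_imset rep_inj); apply: leq_omega.
  by apply/subsetP => _ /imsetP[S /repP[repR _] ->].
apply/cliqueP => _ _ /imsetP[S SF ->] /imsetP[S' S'F ->] ne.
have [[_ eS] [_ eS']] := (repP S SF, repP S' S'F).
move: (SF) (S'F); rewrite !inE => /and3P[_ uS /eqP Sn] /and3P[_ uS' /eqP S'n].
apply: (@incomparable_non_nbrs_adj K _ _ u) => //; rewrite ?eS ?eS' ?Sn ?S'n //.
by apply: contraNneq ne => ->.
Qed.

Lemma card_non_nbr_sets : #|non_nbr_sets| <= #|K| * #|K|.+1 * #|K|.
Proof.
pose F (p : G * 'I_#|K|.+1) :=
  [set S in non_nbr_sets | (p.1 \in S) && (#|S| == p.2)].
have sub : non_nbr_sets \subset \bigcup_(p in setX K setT) F p.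
  apply/subsetP => _ /imsetP[x xR ->].
  have [u uK xu] := maximum_clique_non_nbr maxK xR.
  have lt : #|non_nbrs K x| < #|K|.+1.
    by rewrite ltnS subset_leq_card // non_nbrs_sub.
  apply/bigcupP; exists (u, Ordinal lt); first by rewrite !inE uK.
  by rewrite inE imset_f //= inE uK xu eqxx.
apply: leq_trans (subset_leq_card sub) (leq_trans (card_bigcup_leq _ _) _).
have := @leq_sum_const _ (setX K [set: 'I_#|K|.+1]) (fun p => #|F p|) #|K|.
rewrite cardsX cardsT card_ord; apply=> -[u n] _.
exact: card_non_nbr_sets_through.
Qed.

Lemma chi_touching_maximum_clique A : prime_set A -> R \subset A ->
  chi [set x in R | touches K x] <= #|K| * #|K|.+1 * #|K| * #|K| ^ 6.
Proof.
move=> prA RA; have [KR /cliqueP cK Kw] := maxK.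
pose F S := [set x in R | touches K x && (non_nbrs K x == S)].
have sub : [set x in R | touches K x] \subset \bigcup_(S in non_nbr_sets) F S.
  apply/subsetP => x; rewrite inE => /andP[xR Kx].
  by apply/bigcupP; exists (non_nbrs K x); rewrite ?imset_f // inE xR Kx eqxx.
apply: leq_trans (chiS sub) (leq_trans (chi_bigcup _ _) _).
apply: (@leq_trans (#|non_nbr_sets| * #|K| ^ 6)); last first.
  by rewrite leq_mul // card_non_nbr_sets.
apply: leq_sum_const => S _.
have [->|[x]] := set_0Vmem (F S); first by rewrite chi0.
rewrite inE => /and3P[xR /exists_inP[t tK xt] /eqP eS].
have [s sK xs] := maximum_clique_non_nbr maxK xR.
have FR : F S \subset R by apply: setId_sub.
have FP y u : y \in F S -> u \in K -> adj y u = adj x u.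
  rewrite inE -eS => /and3P[_ _ /eqP/setP/(_ u)]; rewrite !inE => + uK.
  by rewrite uK => /negb_inj.
apply: leq_trans (@chi_centre_anticentre A (F S) t s prA _ _ _ _ _) _.
- exact: subset_trans RA.
- by rewrite (subsetP RA) // (subsetP KR).
- by apply: cK => //; apply: contraTneq xt => ->.
- by move=> y yF; rewrite adj_sym FP.
- by move=> y yF; rewrite adj_sym FP.
- by rewrite leq_expn2r // Kw omegaS.
Qed.
End MaximumClique.

Definition bull_shell_chi (n : nat) : nat := n + n * n.+1 * n * n ^ 6.

Lemma chi_bull_closed_nbhd A R K :
  prime_set A -> R \subset A -> maximum_clique R K ->
  chi (closed_nbhd R K) <= bull_shell_chi (omega R).
Proof.
move=> prA RA maxK; have [_ _ Kw] := maxK; rewrite -Kw.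
apply: leq_trans (chiU _ _) (leq_add (chi_leq_card _) _).
exact: chi_touching_maximum_clique RA.
Qed.

Lemma bull_cross_triangle R K L x y z : maximum_clique R K ->
  L \subset R -> clique L -> #|L| = #|K| -> anticomplete K L ->
  x \in R -> touches K x -> ~~ touches K y -> ~~ touches K z ->
  touches L y -> ~~ touches L z -> adj x y -> adj x z -> ~~ adj y z.
Proof.
move=> [KR cK Kw] LR cL LK KL xR /exists_inP[a aK xa].
move=> /touchesPn Ky /touchesPn Kz /exists_inP[v vL yv] /touchesPn Lz xy xz.
apply/negP => yz.
have [ya za] := (Ky a aK, Kz a aK).
have nbr u : u \in L -> adj y u -> adj x u.
  move=> uL yu; apply/negPn/negP => xu; have [zu au] := (Lz u uL, KL a u aK uL).
  by case/negP: au; apply: (free (a := x) (b := y) (c := z)).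
have xv := nbr v vL yv.
have xL : complete_to L x.
  move=> u uL; have [/nbr-/(_ uL)//|yu] := boolP (adj y u).
  apply/negPn/negP => xu; have [au av] := (KL a u aK uL, KL a v aK vL).
  have vu : adj v u by move/cliqueP: cL; apply=> //; apply: contraTneq yv => ->.
  case/negP: au.
  by apply: (free (a := x) (b := v) (c := y)) => //; rewrite adj_sym.
have xnL : x \notin L by apply/negP => /xL; rewrite adj_irr.
have xLR : x |: L \subset R by rewrite subUset sub1set xR.
by have := leq_omega xLR (cliqueU1 cL xL); rewrite cardsU1 xnL LK Kw ltnn.
Qed.

(* The first component of a label is the size of the maximum clique around which
   the vertex was removed. *)
Definition bull_labelling R (g : G -> nat * nat) : Prop :=
  triangle_free_classes R g /\
  {in R &, forall y z, adj y z -> g y = g z -> exists L,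
     [/\ L \subset R, clique L, #|L| = (g y).1 & touches L y (+) touches L z]}.

Lemma bull_labelling_extend R K (f : G -> nat) g : maximum_clique R K ->
  {in closed_nbhd R K &, forall x y, adj x y -> f x <> f y} ->
  bull_labelling (R :\: closed_nbhd R K) g ->
  bull_labelling R
    (fun x => if x \in closed_nbhd R K then (#|K|, f x) else g x).
Proof.
move=> maxK f_col [g_tri g_edge].
have [KR cK _] := maxK; set B := closed_nbhd R K.
have inD x : x \in R -> x \notin B -> x \in R :\: B.
  by move=> xR xB; apply/setDP.
have notK x : x \in R :\: B -> ~~ touches K x.
  by rewrite !inE => /andP[+ xR]; rewrite xR negb_or => /andP[].
have touchK x y : x \in B -> y \in R :\: B -> adj x y -> touches K x.
  move=> xB yRB xy; case/setUP: xB => [xK|]; last by rewrite inE => /andP[].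
  by have /touchesPn/(_ x xK) := notK y yRB; rewrite adj_sym xy.
split.
  apply: triangle_free_classes_extend => //.
    by move=> x y xB yB xy [fxy]; apply: f_col fxy.
  move=> x y z xB yRB zRB xy xz yz gxy gxz.
  have xR := subsetP (closed_nbhd_sub KR) x xB.
  have [L [LRB cL Ln yzL]] := g_edge y z yRB zRB yz (etrans (esym gxy) gxz).
  have KL : anticomplete K L.
    by move=> a u aK /(subsetP LRB)/notK/touchesPn/(_ a aK); rewrite adj_sym.
  have LK : #|L| = #|K| by rewrite Ln -gxy.
  have LR := subset_trans LRB (subsetDl _ _).
  have Kx := touchK x y xB yRB xy.
  have no_triangle := bull_cross_triangle maxK LR cL LK KL xR Kx.
  have [[Ky Kz] zy] := (notK y yRB, notK z zRB, etrans (adj_sym z y) yz).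
  move: yzL; have [Ly|Ly] := boolP (touches L y);
    have [Lz|Lz] //= := boolP (touches L z).
    by have := no_triangle y z Ky Kz Ly Lz xy xz; rewrite yz.
  by have := no_triangle z y Kz Ky Lz Ly xz xy; rewrite zy.
move=> y z yR zR yz; have zy : adj z y by rewrite adj_sym.
case: ifP => [yB|/negbT/(inD y yR) yB]; case: ifP => [zB|/negbT/(inD z zR) zB].
- by case=> /(f_col y z yB zB yz).
- by exists K; rewrite (touchK y z) // (negPf (notK z zB)).
- by move=> gy; exists K; rewrite gy (touchK z y) // (negPf (notK y yB)).
- move=> /(g_edge y z yB zB yz)[L [LR cL Ln yzL]].
  by exists L; split=> //; apply: subset_trans LR (subsetDl _ _).
Qed.

Lemma exists_bull_labelling A n R :
  prime_set A -> R \subset A -> omega R <= n ->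
  exists2 g, {in R, forall x, (g x).1 <= n /\ (g x).2 < bull_shell_chi n}
    & bull_labelling R g.
Proof.
move=> prA; elim/proper_set_ind: R => R IHR RA Rn.
have [->|[x0 /omega_gt0 w0]] := set_0Vmem R.
  by exists (fun=> (0, 0)); [|split] => x; rewrite inE.
have [K maxK] := exists_maximum_clique R; have [KR cK Kw] := maxK.
have /card_gt0P[u uK] : 0 < #|K| by rewrite Kw.
set B := closed_nbhd R K; have uB : u \in B by rewrite inE uK.
have RBn := leq_trans (omegaS (subsetDl R B)) Rn.
have RBA := subset_trans (subsetDl R B) RA.
have [g gn g_lab] := IHR _ (properDI (subsetP KR u uK) uB) RBA RBn.
have [f [fB f_col]] := chi_colouring B.
exists (fun x => if x \in B then (#|K|, f x) else g x); last first.
  exact: bull_labelling_extend.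
move=> x xR; case: ifP => [xB|/negbT xB]; last by apply: gn; apply/setDP.
rewrite Kw; split=> //; apply: leq_trans (fB x xB) _.
apply: leq_trans (chi_bull_closed_nbhd prA RA maxK) _.
by rewrite leq_add // !leq_mul // leq_expn2r.
Qed.

Lemma chi_bull_prime A B c :
  prime_set A -> B \subset A -> omega_lt_chi_leq G 3 c ->
  chi B <= 2 ^ (6 * c) * omega B ^ 10.
Proof.
move=> prA BA chi_c; set w := omega B.
have [w0|w0] := posnP w; first by rewrite (omega_eq0 w0) chi0.
have [g gw [g_tri _]] := exists_bull_labelling prA BA (leqnn (omega B)).
pose labels := [seq (i, j) | i <- iota 0 w.+1, j <- iota 0 (bull_shell_chi w)].
have g_labels : {in B, forall x, g x \in labels}.
  move=> x /gw[g1 g2].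
  by rewrite (surjective_pairing (g x)) allpairs_f ?mem_iota.
apply: leq_trans (chi_triangle_free_classes g_labels g_tri chi_c) _.
rewrite size_allpairs !size_iota.
have c6 : 6 * c <= 2 ^ (6 * c) by apply: ltnW; apply: ltn_expl.
have w9 : w <= w ^ 9 by rewrite -{1}(expn1 w) leq_pexp2l.
have shell : bull_shell_chi w <= 3 * w ^ 9.
  have e9 : w ^ 9 = w * w * w * w ^ 6 by rewrite !expnS -!mulnA.
  by move: w9; rewrite /bull_shell_chi e9; move: (w ^ 6) => b; nia.
have total : w.+1 * bull_shell_chi w <= 6 * w ^ 10.
  apply: leq_trans (leq_mul (leqnn _) shell) _; rewrite [w ^ 10]expnS.
  by move: (w ^ 9) => b; nia.
apply: leq_trans (leq_mul total (leqnn c)) _.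
by rewrite mulnAC leq_mul2r c6 orbT.
Qed.

Lemma chi_bull_free A c : omega_lt_chi_leq G 3 c ->
  chi A <= omega A ^ (3 + 6 * c + 2 * 10).
Proof.
move=> chi_c; apply: chi_of_prime => H B _ prH BH.
exact: chi_bull_prime BH chi_c.
Qed.
End BullFree.

Lemma strongly_pollyanna_bull : strongly_pollyanna 2%:Z%R (induced_free bull).
Proof.
move=> F /(@good_omega_lt_chi_leq _ 3)[//|c chi_c].
apply: (@poly_chi_bounded_monomial _ 1 (3 + 6 * c + 2 * 10)) => G [free FG] A.
apply: leq_trans (chi_bull_free (induced_free_bull free) A (chi_c G FG)) _.
by rewrite mul1n leq_expn2r.
Qed.

Theorem theorem1p2 (m k t : nat)
    (hm : (0 < m)%N) (hk : (0 < k)%N) (ht : (0 < t)%N) :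
  [/\ strongly_pollyanna (t%:Z - 1)%R (induced_free (mK m t)),
      strongly_pollyanna (2 * t%:Z - 4)%R (induced_free (pineapple t k)),
      strongly_pollyanna (3 * t%:Z - 6)%R (induced_free (lollipop t)),
      strongly_pollyanna 3%:Z (induced_free bowtie)
    & strongly_pollyanna 2%:Z (induced_free bull)].
Proof.
split.
- exact: strongly_pollyanna_mK.
- exact: strongly_pollyanna_pineapple.
- exact: strongly_pollyanna_lollipop.
- exact: strongly_pollyanna_bowtie.
- exact: strongly_pollyanna_bull.
Qed.
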